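(* For every $\varphi\in L^\infty(X,m)$, $$\lambda(\varphi)=\max_{\mu\in M_\alpha(X,m)}\bigl(\mu(\varphi)+\tau(\mu)\bigr),$$ where $\lambda(\varphi)$ is the logarithm of the spectral radius of the weighted shift operator $A_\varphi$ on $L^1(X,m)$ and $\tau(\mu)$ is the $t$-entropy of $\mu$ (in particular, the maximum is attained).
   Context: Setting: $(X,\mathfrak A)$ is a measurable space with a $\sigma$-finite (nonzero) measure $m$, and $\alpha:X\to X$ is a measurable mapping. The shift operator $Af=f\circ\alpha$ is assumed to be bounded on the real space $L^1(X,m)$; equivalently there is a constant $C$ with $m(\alpha^{-1}(G))\le C\,m(G)$ for all $G\in\mathfrak A$. $L^\infty(X,m)$ is the space of essentially bounded real-valued functions. Weighted shift operator: for $\varphi\in L^\infty(X,m)$, $[A_\varphi f](x)=e^{\varphi(x)}f(\alpha(x))$ for $f\in L^1(X,m)$, and $$\lambda(\varphi)=\lim_{n\to\infty}\frac1n\ln\|A_\varphi^n\|$$ (operator norm on $L^1(X,m)$). Measures: $M(X,m)$ is the set of all positive normalized linear functionals $\mu$ on $L^\infty(X,m)$ (positive: $\mu(f)\ge0$ for $f\ge0$; normalized: $\mu(1)=1$). They are identified with finitely additive probability measures on $\mathfrak A$ absolutely continuous with respect to $m$. A functional $\mu\in M(X,m)$ is $\alpha$-invariant if $\mu(f\circ\alpha)=\mu(f)$ for all $f\in L^\infty(X,m)$; $M_\alpha(X,m)$ is the set of all $\alpha$-invariant $\mu\in M(X,m)$. A measurable partition of unity on $X$ is a finite set $D=\{g_1,\dots,g_k\}$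 of nonnegative functions $g_i\in L^\infty(X,m)$ with $g_1+\dots+g_k\equiv1$ almost everywhere. $t$-entropy: for $\mu\in M(X,m)$, $$\tau(\mu)=\inf_{n\in\mathbb N}\frac{\tau_n(\mu)}n,\qquad \tau_n(\mu)=\inf_D\tau_n(\mu,D),\qquad \tau_n(\mu,D)=\sup_{\|f\|=1}\sum_{g\in D}\mu(g)\ln\frac{\int_X g\,|f\circ\alpha^n|\,dm}{\mu(g)},$$ where the infimum is over all measurable partitions of unity $D$ on $X$ and the supremum over all $f\in L^1(X,m)$ with $\|f\|=1$ ($L^1$-norm). If $\mu(g)=0$ the corresponding summand is taken to be $0$ regardless of the integral; if some $g\in D$ has $\int_X g\,dm=0$ and $\mu(g)>0$, then $\tau(\mu)=-\infty$. Values lie in $[-\infty,\infty)$, with $\ln 0=-\infty$. *)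

(* Defs.v *)
From HB Require Import structures.
From mathcomp Require Import all_boot all_order all_algebra.
From mathcomp Require Import all_classical all_reals all_analysis.
From mathcomp Require Import measurable_realfun.
Set Implicit Arguments.
Unset Strict Implicit.
Unset Printing Implicit Defensive.
Import Order.TTheory GRing.Theory Num.Theory.
Import numFieldNormedType.Exports.
Local Open Scope classical_set_scope.
Local Open Scope ring_scope.

(* As in the library, an element of L^p is represented by a function (a
   [LfunType]), not by its class modulo equality a.e.; the definitions below
   are insensitive to the choice of representatives. *)
Notation L1 m := (LfunType m (lexx (1%E : \bar _))).
Notation Linfty m := (LfunType m (leey (1%E : \bar _))).

Section shift.
Context d (X : measurableType d) (R : realType).
Variables (m : {measure set X -> \bar R}) (alpha : {mfun X >-> X}).
Local Open Scope ereal_scope.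

Definition shift_bounded := exists C : R, forall f : L1 m,
  'N[m]_1[EFin \o (f \o alpha)] <= C%:E * 'N[m]_1[EFin \o f].

Lemma shift_bounded_null (G : set X) : shift_bounded ->
  measurable G -> m G = 0 -> m (alpha @^-1` G) = 0.
Proof.
move=> [C hC] mG mG0.
have mA : measurable (alpha @^-1` G).
  by rewrite -[X in measurable X]setTI; exact: measurable_funPT.
have NE (A : set X) : measurable A -> 'N[m]_1[EFin \o \1_A] = m A.
  move=> mB; rewrite Lnorm1.
  under eq_integral do rewrite /= ger0_norm//.
  by rewrite integral_indic// setIT.
have inL : (\1_G : X -> R) \in Lfun m 1.
  rewrite inE; apply/andP; split; rewrite inE/=; first exact: measurable_indic.
  by rewrite /finite_norm NE// mG0.
have /= := hC (Lfun_Sub (lexx 1) inL).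
rewrite NE// (NE G)// mG0 mule0 => h.
by apply/eqP; rewrite eq_le h measure_ge0.
Qed.

Lemma Linfty_comp (hA : shift_bounded) (f : Linfty m) :
  (f \o alpha)%FUN \in Lfun m +oo.
Proof.
rewrite inE; apply/andP; split; rewrite inE/=.
  exact: measurableT_comp.
have : finite_norm m +oo f by exact: Lfunction_finite.
rewrite /finite_norm.
rewrite unlock/=; case: ifPn => // m0 hf.
apply: le_lt_trans hf; apply: ereal_inf_le_tmp => y/= hy.
case: hy => N [mN N0 sN]; exists (alpha @^-1` N); split.
- by rewrite -[X in measurable X]setTI; exact: measurable_funPT.
- exact: shift_bounded_null.
- by move=> x hx; apply: sN.
Qed.

Definition Linfty_shift (hA : shift_bounded) (f : Linfty m) : Linfty m :=
  Lfun_Sub (leey 1) (Linfty_comp hA f).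

Lemma Linfty_cst1 : (cst 1%R : X -> R) \in Lfun m +oo.
Proof.
rewrite inE; apply/andP; split; rewrite inE/=; first exact: measurable_cst.
rewrite /finite_norm unlock/=; case: ifPn => // _.
apply: (@le_lt_trans _ _ 1); last exact: ltry.
apply: ereal_inf_lbound => /=.
by apply: aeW => x /=; rewrite normr1.
Qed.

Definition Linfty1 : Linfty m := Lfun_Sub (leey 1) Linfty_cst1.

Definition states : set {scalar Linfty m} :=
  [set mu | [/\ forall f g : Linfty m, f = g %[ae m] -> mu f = mu g,
               forall f : Linfty m, {ae m, forall x, (0 <= f x)%R} ->
                 (0 <= mu f)%R
             & mu Linfty1 = 1%R]].

Definition invariant_states (hA : shift_bounded) : set {scalar Linfty m} :=
  [set mu | states mu /\ forall f, mu (Linfty_shift hA f) = mu f].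

Definition weighted_shift (phi f : X -> R) : X -> R :=
  fun x => (expR (phi x) * f (alpha x))%R.

Definition L1_opnorm (B : (X -> R) -> (X -> R)) : \bar R :=
  ereal_sup [set 'N[m]_1[EFin \o B f] |
    f in [set f : L1 m | 'N[m]_1[EFin \o f] <= 1]].

Definition log_norm_seq (phi : X -> R) (n : nat) : \bar R :=
  (n%:R^-1)%:E * lne (L1_opnorm (iter n (weighted_shift phi))).

(* The logarithm may be -oo: the spectral radius can be 0. *)
Definition lambda (phi : X -> R) : \bar R := limn (log_norm_seq phi).

(* A partition is given as the list g_1, ..., g_k of its members. *)
Definition partition_of_unity (D : seq (Linfty m)) :=
  (forall g, g \in D -> {ae m, forall x, (0 <= g x)%R}) /\
  {ae m, forall x, (\sum_(g <- D) g x)%R = 1%R}.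

Definition tau_nD (n : nat) (mu : {scalar Linfty m}) (D : seq (Linfty m)) :
    \bar R :=
  ereal_sup [set
    \sum_(g <- D)
      (if mu g == 0%R then 0 else
       (mu g)%:E *
       lne ((\int[m]_x (g x * `|f (iter n alpha x)|)%:E) * ((mu g)^-1)%:E))
    | f in [set f : L1 m | 'N[m]_1[EFin \o f] = 1]].

Definition tau_n (n : nat) (mu : {scalar Linfty m}) : \bar R :=
  ereal_inf [set tau_nD n mu D | D in partition_of_unity].

Definition t_entropy (mu : {scalar Linfty m}) : \bar R :=
  ereal_inf [set (n%:R^-1)%:E * tau_n n mu | n in [set n | (0 < n)%N]].

End shift.

(* Main.v *)
Require Import Defs.
From HB Require Import structures.
From mathcomp Require Import all_boot all_order all_algebra.
From mathcomp Require Import all_classical all_reals all_analysis.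
From mathcomp Require Import measurable_realfun ess_sup_inf ring lra.
Set Implicit Arguments.
Unset Strict Implicit.
Unset Printing Implicit Defensive.
Import Order.TTheory GRing.Theory Num.Theory.
Import numFieldNormedType.Exports.
Local Open Scope classical_set_scope.
Local Open Scope ring_scope.

(** The spectral radius is governed by the norms on L^1 of the operators
    f |-> e^psi (f o alpha^n).  Let P n psi be the logarithm of this norm
    ([pressure]) and S_n psi the Birkhoff sum of psi, so that
    lambda(phi) = lim P n (S_n phi) / n.  As a function of psi, P n is monotone,
    commutes with the addition of constants and is convex; composing operators
    gives P (n + k) (psi + chi o alpha^n) <= P n psi + P k chi.  In particular
    P n (S_n phi) is subadditive in n and the limit exists and is an infimum
    ([log_norm_seq_cvg]).

    Upper bound.  Cut X into level sets of S_n phi that are so thin that S_n phi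
    is nearly a constant t_i on each piece g_i.  Gibbs' inequality gives, for
    every f of norm 1 and x_i the integral of g_i |f o alpha^n|,
      sum mu(g_i) ln (x_i / mu(g_i)) + sum t_i mu(g_i) <= ln (sum e^(t_i) x_i),
    whose right-hand side is at most about P n (S_n phi).  Hence
    mu(S_n phi) + tau_n(mu) <= P n (S_n phi) ([tau_n_le]), where
    mu(S_n phi) = n mu(phi) by invariance.

    Attainment.  The upper growth rate of P n (S_n (phi + psi)) - P n (S_n phi)
    is a finite convex function of psi, even if lambda(phi) = -oo, and vanishes
    at 0; by a Hahn-Banach argument ([linear_below_convex]) there is a linear
    functional mu below it.  Such a mu is automatically an invariant state
    ([subgradient_invariant]).  If lambda(phi) = -oo, the upper bound already
    forces equality.  Otherwise mu is a subgradient of lambda at phi; since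
    lambda(Psi / k) <= P k Psi / k, by averaging over residues of times modulo k,
    one gets
      k (lambda(phi) - mu(phi)) + mu(Psi) <= P k Psi   for all k > 0 and Psi
    ([subgradient_le_pressure]).  For a partition of unity (g_i) and
    Psi = sum t_i g_i, convexity of the exponential gives
    e^Psi <= sum e^(t_i) g_i, so this bounds from below the suprema of
    sum e^(t_i) x_i over the convex set K of the vectors
    x_i = integral of g_i |f o alpha^k|, for all t.  Concavity of
    x |-> sum mu(g_i) ln x_i turns these bounds into a lower bound for the supremum
    over K of sum mu(g_i) ln (x_i / mu(g_i)), which is tau_k(mu, D)
    ([entropy_duality], [tau_n_ge]). *)

(** * Subadditive sequences *)

(** Write n = q k + r.  The remainder r costs a bounded amount, which the gain
    q (k y - a k) absorbs once q is large. *)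
Lemma subadditive_eventually_le (R : realType) (a : nat -> R) (k : nat) (y : R) :
  (forall n j, a (n + j)%N <= a n + a j) -> (0 < k)%N -> a k < k%:R * y ->
  \forall n \near \oo, a n <= n%:R * y.
Proof.
move=> asub k0 aky.
have amul q r : a (q * k + r)%N <= q%:R * a k + a r.
  elim: q => [|q IH]; first by rewrite mul0n add0n mul0r add0r.
  rewrite mulSn -addnA (le_trans (asub _ _))//.
  by rewrite -natr1 mulrDl mul1r (addrC _ (a k)) -addrA lerD2l.
pose M := \sum_(r < k) `|a r - r%:R * y|.
have MP (r : nat) : (r < k)%N -> a r - r%:R * y <= M.
  move=> rk; rewrite (le_trans (ler_norm _))// /M (bigD1 (Ordinal rk))//=.
  by rewrite lerDl sumr_ge0.
pose e := k%:R * y - a k.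
have e0 : 0 < e by rewrite subr_gt0.
have [q qP] : exists q : nat, M / e < q%:R.
  by exists (Num.truncn (M / e)).+1; rewrite truncnS_gt.
exists (q * k)%N => // n /= qn.
have -> : n = (n %/ k * k + n %% k)%N by rewrite -divn_eq.
have hr : (n %% k < k)%N by rewrite ltn_mod.
have hq : (q <= n %/ k)%N by rewrite leq_divRL.
apply: (le_trans (amul _ _)).
have := MP _ hr; set r := (n %% k)%N; set p := (n %/ k)%N => hM.
have Mpe : M <= p%:R * e.
  rewrite -ler_pdivrMr//; apply: (le_trans (ltW qP)).
  by rewrite ler_nat.
rewrite natrD natrM mulrDl -lerBlDl.
move: Mpe; rewrite /e mulrBr => Mpe.
lra.
Qed.

(** Fekete's lemma, stated in the extended reals because the limit may be
    -oo. *)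
Lemma subadditive_cvg (R : realType) (a : nat -> R) :
  (forall n j, a (n + j)%N <= a n + a j) ->
  (n%:R^-1 * a n)%:E @[n --> \oo] -->
    ereal_inf [set (n%:R^-1 * a n)%:E | n in [set n | (0 < n)%N]].
Proof.
move=> asub; set l := ereal_inf _.
have lb (n : nat) : (0 < n)%N -> (l <= (n%:R^-1 * a n)%:E)%E.
  by move=> n0; apply: ereal_inf_lbound; exists n.
have ub (y : R) : (l < y%:E)%E -> \forall n \near \oo, n%:R^-1 * a n <= y.
  move=> /ereal_inf_lt[_ [k /= k0 <-]]; rewrite lte_fin => ky.
  have : a k < k%:R * y by rewrite -ltr_pdivrMl ?ltr0n.
  move=> /(subadditive_eventually_le asub k0) [N _ NP].
  exists N.+1 => // n /= Nn.
  by rewrite ler_pdivrMl ?ltr0n ?(leq_ltn_trans _ Nn)//; apply: NP; exact: ltnW.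
have [lNy|lNy] := eqVneq l -oo%E.
  rewrite lNy; apply/cvgeNyPle => y.
  have : (l < y%:E)%E by rewrite lNy ltNyr.
  by move=> /ub; apply: filterS => n; rewrite lee_fin.
have lfin : l \is a fin_num.
  rewrite fin_numE lNy/=; apply/negP => /eqP ly.
  by have := lb 1%N isT; rewrite ly.
rewrite -(fineK lfin); apply: cvg_EFin; first exact: nearW.
apply/cvgrPdist_le => e e0.
have : (l < (fine l + e)%:E)%E.
  by rewrite -[ltLHS](fineK lfin) lte_fin ltrDl.
move=> /ub [N _ NP]; exists N.+1 => // n /= Nn.
have := NP n (ltnW Nn).
have n0 : (0 < n)%N by exact: leq_ltn_trans Nn.
have := lb n n0; rewrite -[X in (X <= _)%E](fineK lfin) lee_fin => h1 h2.
by rewrite ler_distl/=; apply/andP; split; lra.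
Qed.

(** * Linear functionals below a convex function *)

Section minimal_convex.
Context (R : realType) (V : lmodType R).
Implicit Types p q : V -> R.

Definition convex_on p := forall (s : R) x y, 0 <= s <= 1 ->
  p (s *: x + (1 - s) *: y) <= s * p x + (1 - s) * p y.

Variable p : V -> R.
Hypotheses (pcvx : convex_on p) (p0 : p 0 = 0).

Definition convex_below q := [/\ convex_on q, q 0 = 0 & forall x, q x <= p x].

(** 0 is the midpoint of x and - x.  This bound keeps the pointwise infimum of a
    chain finite. *)
Lemma convex_below_lb q x : convex_below q -> - p (- x) <= q x.
Proof.
move=> [qc q0 qp].
have := qc (2^-1) x (- x).
have -> : (1 - 2^-1 = 2^-1 :> R) by lra.
rewrite -scalerDr subrr scaler0 q0 => /(_ _)/wrap[|]; first by apply/andP; split; lra.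
by have := qp (- x); lra.
Qed.

(** Zorn's lemma: the pointwise infimum of a chain of convex functions is again
    convex, since two members of a chain can be replaced by the smaller one. *)
Lemma minimal_convex_below : exists2 q, convex_below q &
  forall q', convex_below q' -> (forall x, q' x <= q x) -> q' = q.
Proof.
pose T := {q | convex_below q}.
pose le (q q' : T) : bool := `[< forall x, sval q' x <= sval q x >].
have [||||[q qP] qmin] := @Zorn T le.
- by move=> q; apply/asboolP.
- move=> q r s /asboolP qr /asboolP rs; apply/asboolP => x.
  exact: le_trans (rs x) (qr x).
- move=> [q qP] [r rP] /asboolP/= qr /asboolP/= rq.
  have e : q = r by apply/funext => x; apply/le_anti; rewrite qr rq.
  by subst r; congr exist; exact: Prop_irrelevance.
- move=> A Atot.
  have [->|/set0P[a0 Aa0]] := eqVneq A set0.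
    by exists (exist _ p (And3 pcvx p0 (fun x => lexx (p x)))).
  pose E x := [set sval q x | q in A].
  pose q x := inf (E x).
  have Eh x : has_lbound (E x).
    by exists (- p (- x)) => _ [r _ <-]; exact: convex_below_lb (svalP r).
  have qle r x : A r -> q x <= sval r x by move=> Ar; apply: ge_inf => //; exists r.
  have qlt x y : q x < y -> exists2 r, A r & sval r x < y.
    move=> h; have [||_ [r Ar <-]] := @inf_adherent _ (E x) (y - q x).
    + by rewrite subr_gt0.
    + by split => //; exists (sval a0 x); exists a0.
    + by rewrite -/(q x) addrC subrK => ?; exists r.
  have qP : convex_below q.
    split.
    + move=> s x y s01; apply/ler_addgt0Pr => e e0.
      have [|r Ar rx] := qlt x (q x + e); first by rewrite ltrDl.
      have [|t At ty] := qlt y (q y + e); first by rewrite ltrDl.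
      have [u [Au ux uy]] : exists u, [/\ A u, sval u x <= q x + e &
          sval u y <= q y + e].
        have [/asboolP rt|/asboolP tr] := Atot _ _ Ar At.
          by exists t; split => //; [exact: le_trans (rt x) (ltW rx)|exact: ltW].
        by exists r; split => //; [exact: ltW|exact: le_trans (tr y) (ltW ty)].
      apply: (le_trans (qle u _ Au)).
      have [uc _ _] := svalP u; apply: (le_trans (uc _ _ _ s01)).
      case/andP: s01 => s0 s1.
      have h1 : s * sval u x <= s * (q x + e) by rewrite ler_wpM2l.
      have h2 : (1 - s) * sval u y <= (1 - s) * (q y + e).
        by rewrite ler_wpM2l// subr_ge0.
      by move: h1 h2; rewrite !mulrDr; lra.
    + have E0 : E 0 = [set 0].
        apply/seteqP; split => [_ [r _ <-]|_ ->] /=; first by have [] := svalP r.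
        by exists a0 => //; have [] := svalP a0.
      by rewrite /q E0 inf1.
    + by move=> x; apply: (le_trans (qle a0 x Aa0)); have [] := svalP a0.
  by exists (exist _ q qP) => r Ar; apply/asboolP => x; exact: qle.
exists q => // q' q'P q'q.
have /(_ _)/wrap[|] := qmin (exist _ q' q'P); first exact/asboolP.
by case.
Qed.

(** Minimality is used twice, each time against a competitor built from q.
    By convexity x |-> 2 q(x / 2) lies below q, hence equals q, and convexity
    then says that q is subadditive.  By subadditivity x |-> q(x + y) - q(y)
    lies below q, hence equals q. *)
Lemma minimal_convex_additive q : convex_below q ->
  (forall q', convex_below q' -> (forall x, q' x <= q x) -> q' = q) ->
  forall x y, q (x + y) = q x + q y.
Proof.
move=> [qc q0 qp] qmin.
have half x : q (2^-1 *: x) = 2^-1 * q x.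
  pose r x := 2 * q (2^-1 *: x).
  have rq z : r z <= q z.
    have := qc (2^-1) z 0; rewrite scaler0 addr0 q0 mulr0 addr0 /r.
    by move=> /(_ _)/wrap[|]; [apply/andP; split; lra|lra].
  have /(congr1 (fun f => f x)) : r = q.
    apply: qmin => //; split.
    - move=> s y z s01; rewrite /r scalerDr !scalerA (mulrC _ s) (mulrC _ (1 - s)).
      by rewrite -!scalerA; have := qc s (2^-1 *: y) (2^-1 *: z) s01; lra.
    - by rewrite /r scaler0 q0 mulr0.
    - by move=> y; exact: le_trans (rq y) (qp y).
  by rewrite /r => <-; lra.
have subq x y : q (x + y) <= q x + q y.
  have := qc (2^-1) x y; have -> : (1 - 2^-1 = 2^-1 :> R) by lra.
  rewrite -scalerDr half => /(_ _)/wrap[|]; first by apply/andP; split; lra.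
  by lra.
move=> x y; pose r x := q (x + y) - q y.
have rq z : r z <= q z by rewrite /r lerBlDr subq.
have /(congr1 (fun f => f x)) : r = q.
  apply: qmin => //; split.
  - move=> s u v s01; rewrite /r.
    have -> : s *: u + (1 - s) *: v + y = s *: (u + y) + (1 - s) *: (v + y).
      rewrite !scalerDr addrACA; congr (_ + _).
      by rewrite -scalerDl addrC subrK scale1r.
    by have := qc s (u + y) (v + y) s01; lra.
  - by rewrite /r add0r subrr.
  - by move=> z; exact: le_trans (rq z) (qp z).
by rewrite /r; lra.
Qed.

(** A Hahn-Banach theorem for convex functions: a minimal element among the
    convex functions below p that vanish at 0 is additive by
    [minimal_convex_additive], and convexity along the segment from 0 to x gives
    homogeneity. *)
Lemma linear_below_convex : exists g : {scalar V}, forall x, g x <= p x.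
Proof.
have [q qP qmin] := minimal_convex_below.
have qD := minimal_convex_additive qP qmin.
have [qc q0 qp] := qP.
have qN x : q (- x) = - q x.
  by apply/eqP; rewrite -addr_eq0 -qD addrC subrr q0.
have q01 s x : 0 <= s <= 1 -> q (s *: x) = s * q x.
  move=> s01; apply/eqP; rewrite eq_le; apply/andP; split.
    by have := qc s x 0 s01; rewrite scaler0 q0 mulr0 !addr0.
  have := qc s (- x) 0 s01; rewrite scaler0 q0 mulr0 !addr0 scalerN !qN.
  by rewrite mulrN lerN2.
have q1 s x : 0 <= s -> q (s *: x) = s * q x.
  move=> s0; have [s1|s1] := leP s 1; first by apply: q01; rewrite s0.
  have sn : s != 0 by rewrite gt_eqF// (lt_trans ltr01).
  have := q01 s^-1 (s *: x); rewrite scalerA mulVf// scale1r => -> //.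
    by rewrite mulrA divff// mul1r.
  by rewrite invr_ge0 s0/= invf_le1// ?ltW// (lt_trans ltr01).
have qZ s x : q (s *: x) = s * q x.
  have [s0|s0] := leP 0 s; first exact: q1.
  rewrite -[s]opprK scaleNr qN q1 ?oppr_ge0 ?ltW//.
  by rewrite !mulNr.
have qlin : linear_for *%R q by move=> s x y; rewrite qD qZ.
pose gM := GRing.isLinear.Build R V R *%R q qlin.
pose g : {scalar V} := HB.pack q gM.
by exists g.
Qed.

End minimal_convex.

(** * Gibbs' inequality and entropy duality *)

Lemma ln_le_subr1 (R : realType) (x : R) : 0 < x -> ln x <= x - 1.
Proof. by move=> x0; have := expR_ge1Dx (ln x); rewrite lnK ?posrE//; lra. Qed.

Lemma sum1_exists_gt0 (R : realType) (I : finType) (p : I -> R) :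
  \sum_i p i = 1 -> exists i, 0 < p i.
Proof.
move=> p1; apply: contrapT => /forallNP np; have : \sum_i p i <= 0.
  by apply: sumr_le0 => i _; rewrite leNgt; exact/negP.
by rewrite p1 ler10.
Qed.

(** Apply ln z <= z - 1 to z = y_i / (p_i * sum y) and average with weights
    p_i. *)
Lemma gibbs_inequality (R : realType) (I : finType) (p y : I -> R) :
  (forall i, 0 <= p i) -> \sum_i p i = 1 ->
  (forall i, 0 <= y i) -> (forall i, 0 < p i -> 0 < y i) ->
  \sum_i p i * ln (y i / p i) <= ln (\sum_i y i).
Proof.
move=> p0 p1 y0 py; set S := \sum_i y i.
have S0 : 0 < S.
  have [i pi0] := sum1_exists_gt0 p1.
  by rewrite /S (bigD1 i)//= ltr_pwDl ?py// sumr_ge0.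
rewrite -subr_le0 -[X in _ - X]mul1r -p1 mulr_suml -sumrB.
rewrite [leRHS](_ : 0 = \sum_i (y i / S - p i)); last first.
  by rewrite sumrB p1 -mulr_suml mulfV ?gt_eqF// subrr.
apply: ler_sum => i _.
have := p0 i; rewrite le_eqVlt => /predU1P[<-|pi0].
  by rewrite !mul0r !subr0 divr_ge0// ltW.
have yi0 := py i pi0.
rewrite -mulrBr -ln_div ?posrE ?divr_gt0//.
have := ln_le_subr1 (divr_gt0 (divr_gt0 yi0 pi0) S0) => h.
apply: (le_trans (ler_wpM2l (ltW pi0) h)).
by rewrite mulrBr mulr1 lerB// mulrA mulrCA divff ?gt_eqF// mulr1.
Qed.

(** Here K is a bounded convex set of nonnegative vectors whose suprema of all
    positive linear forms are bounded below, in logarithmic form, by an affine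
    function of the logarithms t_i of the coefficients. *)
Section entropy_duality.
Context (R : realType) (I : finType).
Variables (p : I -> R) (K : set (I -> R)) (c B : R).
Hypotheses (p_ge0 : forall i, 0 <= p i) (p_sum1 : \sum_i p i = 1).
Hypothesis K_convex : forall x y (s : R), K x -> K y -> 0 <= s <= 1 ->
  K (fun i => (1 - s) * x i + s * y i).
Hypotheses (K_ge0 : forall x i, K x -> 0 <= x i)
           (K_leB : forall x i, K x -> x i <= B).
Hypothesis K_dual : forall (t : I -> R) y,
  (forall x, K x -> \sum_i expR (t i) * x i <= y) ->
  expR (c + \sum_i p i * t i) <= y.

Let K_nonempty : K !=set0.
Proof.
apply/set0P/eqP => K0.
have := @K_dual (fun=> 0) 0; rewrite K0 => /(_ _)/wrap[//|].
by rewrite leNgt expR_gt0.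
Qed.

Let B_ge0 : 0 <= B.
Proof.
have [x Kx] := K_nonempty.
have [i _] := sum1_exists_gt0 p_sum1.
by rewrite (le_trans (K_ge0 i Kx))// K_leB.
Qed.

(** Were the coordinate i identically 0 on K, the coefficient e^W at i would not
    influence the linear form, whereas the lower bound grows like e^(p_i W). *)
Let K_pos_at i : 0 < p i -> exists2 x, K x & 0 < x i.
Proof.
move=> pi0; apply: contrapT => /forall2NP nK.
have xi0 x : K x -> x i = 0.
  move=> Kx; have [//|] := nK x => /negP; rewrite -leNgt => xi0.
  by apply/le_anti; rewrite xi0 K_ge0.
pose y := #|I|%:R * B.
have K_W W : expR (c + p i * W) <= y.
  have := @K_dual (fun j => if j == i then W else 0) y.
  rewrite (bigD1 i)//= eqxx big1 ?addr0; last first.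
    by move=> j /negPf ->; rewrite mulr0.
  apply=> x Kx; rewrite (bigD1 i)//= xi0// mulr0 add0r.
  rewrite /y -sum1_card natr_sum mulr_suml [leRHS](bigD1 i)//= mul1r.
  rewrite ler_wpDl//; apply: ler_sum => j /negPf ->.
  by rewrite expR0 !mul1r K_leB.
have y0 : 0 < y by apply: lt_le_trans (K_W 0); exact: expR_gt0.
have := K_W ((ln y - c + 1) / p i).
rewrite mulrCA divff ?gt_eqF// mulr1 (_ : c + _ = ln y + 1); last by lra.
rewrite expRD lnK ?posrE// ger_pMr// leNgt => /negP; apply.
by rewrite expR_gt1.
Qed.

Let K_pos : exists2 x, K x & forall i, 0 < p i -> 0 < x i.
Proof.
suff [x Kx xP] : exists2 x, K x & forall i, i \in enum I -> 0 < p i -> 0 < x i.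
  by exists x => // i; apply: xP; rewrite mem_enum.
elim: (enum I) => [|j s [x Kx xP]]; first by have [x Kx] := K_nonempty; exists x.
have [pj0|pj0] := ltP 0 (p j); last first.
  exists x => // i; rewrite inE => /predU1P[->|]; last exact: xP.
  by rewrite ltNge pj0.
have [y Ky yj] := K_pos_at pj0.
exists (fun i => (1 - 2^-1) * x i + 2^-1 * y i).
  by apply: K_convex => //; apply/andP; split; lra.
have -> : (1 - 2^-1 = 2^-1 :> R) by lra.
move=> i; rewrite inE => /predU1P[->|/xP xi0] pi0.
  by have := K_ge0 j Kx; lra.
by have := xi0 pi0; have := K_ge0 i Ky; lra.
Qed.

(** First-order optimality.  If y nearly maximizes F = sum p_i ln y_i, then a
    step of length s from y towards z gains to first order
    s * sum p_i (z_i - y_i) / y_i and loses at most 2 (s M)^2 to second order.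
    A point that is optimal up to s^2 therefore satisfies the first-order
    condition up to s (1 + 2 M^2).  Working with near maximizers avoids any
    compactness. *)
Lemma near_maximizer (K' : set (I -> R)) (x0 : I -> R) (d M : R) :
  K' x0 -> K' `<=` K ->
  (forall x y (s : R), K' x -> K' y -> 0 <= s <= 1 ->
    K' (fun i => (1 - s) * x i + s * y i)) ->
  (forall x i, K' x -> 0 < p i -> 0 < x i) ->
  (forall x y i, K' x -> K' y -> 0 < p i -> `|(y i - x i) / x i| <= M) ->
  0 < d <= 1 ->
  exists2 y, K' y & forall z, K' z -> \sum_i p i * (z i / y i) <= 1 + d.
Proof.
move=> K'x0 K'K K'cvx K'pos K'M /andP[d0 d1].
pose F (y : I -> R) := \sum_i p i * ln (y i).
(* this step makes the error s (1 + 2 M^2) equal to d, and s M <= 1/2 *)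
pose s := d / (1 + 2 * M ^+ 2).
have den0 : 0 < 1 + 2 * M ^+ 2 by have := sqr_ge0 M; lra.
have s0 : 0 < s by rewrite divr_gt0.
have sden : s * (1 + 2 * M ^+ 2) = d by rewrite /s divfK// gt_eqF.
have FB y : K' y -> F y <= B.
  move=> K'y; rewrite -[B]mul1r -p_sum1 mulr_suml; apply: ler_sum => i _.
  have := p_ge0 i; rewrite le_eqVlt => /predU1P[<-|pi0]; first by rewrite !mul0r.
  apply: ler_wpM2l => //; apply: (le_trans (ln_le_subr1 (K'pos _ _ K'y pi0))).
  by have := K_leB i (K'K _ K'y); lra.
have [_ [y K'y <-] yP] : exists2 e, [set F y | y in K'] e &
    sup [set F y | y in K'] - s ^+ 2 < e.
  apply: sup_adherent; first by rewrite exprn_gt0.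
  split; first by exists (F x0), x0.
  by exists B => _ [y K'y <-]; exact: FB.
have {}yP z : K' z -> F z - F y <= s ^+ 2.
  move=> K'z; rewrite lerBlDr -lerBlDl; apply: ltW; apply: le_lt_trans yP.
  rewrite lerD2r; apply: ub_le_sup; last by exists z.
  by exists B => _ [x K'x <-]; exact: FB.
exists y => // z K'z.
pose v i := (z i - y i) / y i.
have s1 : s <= 1.
  rewrite /s ler_pdivrMr// mul1r; have := sqr_ge0 M; lra.
have K'w : K' (fun i => (1 - s) * y i + s * z i) by apply: K'cvx; rewrite ?(ltW s0).
have key : \sum_i p i * (s * v i - 2 * (s * M) ^+ 2) <= s ^+ 2.
  apply: le_trans (yP _ K'w); rewrite /F -sumrB; apply: ler_sum => i _.
  have := p_ge0 i; rewrite le_eqVlt => /predU1P[<-|pi0].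
    by rewrite !mul0r subrr.
  rewrite -mulrBr; apply: ler_wpM2l => //.
  have yi0 := K'pos _ _ K'y pi0; have wi0 := K'pos _ _ K'w pi0.
  rewrite -ln_div ?posrE//.
  have -> : ((1 - s) * y i + s * z i) / y i = 1 + s * v i.
    by rewrite /v; field; rewrite gt_eqF.
  have u0 : 0 < 1 + s * v i.
    have <- : ((1 - s) * y i + s * z i) / y i = 1 + s * v i.
      by rewrite /v; field; rewrite gt_eqF.
    by rewrite divr_gt0.
  have vM : `|v i| <= M by exact: K'M.
  have M0 : 0 <= M by exact: le_trans vM.
  have sM : s * M <= 2^-1.
    have : 2 * M <= 1 + 2 * M ^+ 2 by nra.
    move=> h; have : s * (2 * M) <= s * (1 + 2 * M ^+ 2) by rewrite ler_wpM2l// ltW.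
    rewrite sden; lra.
  set u := s * v i in u0 *.
  have uM : `|u| <= s * M by rewrite normrM gtr0_norm// ler_wpM2l// ltW.
  have u2 : u ^+ 2 <= (s * M) ^+ 2.
    by rewrite -[u ^+ 2]real_normK ?num_real// lerXn2r// nnegrE mulr_ge0// ltW.
  have uh : 2^-1 <= 1 + u by move: uM; rewrite ler_norml; lra.
  have : 1 - (1 + u)^-1 <= ln (1 + u).
    have := @ln_le_subr1 R (1 + u)^-1; rewrite invr_gt0 lnV ?posrE// => /(_ u0).
    lra.
  apply: le_trans.
  have -> : 1 - (1 + u)^-1 = u - u ^+ 2 * (1 + u)^-1.
    by field; rewrite gt_eqF.
  have : (1 + u)^-1 <= 2.
    by rewrite -[leRHS]invrK lef_pV2 ?posrE// invr_gt0.
  have : 0 <= (1 + u)^-1 by rewrite invr_ge0 ltW.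
  have := sqr_ge0 u; nra.
have e1 : \sum_i p i * (s * v i - 2 * (s * M) ^+ 2) =
    s * (\sum_i p i * v i) - 2 * (s * M) ^+ 2.
  rewrite -[X in _ = _ - X]mul1r -p_sum1 mulr_suml mulr_sumr -sumrB.
  by apply: eq_bigr => i _; ring.
have e2 : \sum_i p i * (z i / y i) = 1 + \sum_i p i * v i.
  rewrite -[X in _ = X + _]p_sum1 -big_split/=; apply: eq_bigr => i _.
  have := p_ge0 i; rewrite le_eqVlt => /predU1P[<-|pi0]; first by rewrite !mul0r add0r.
  have yi0 := K'pos _ _ K'y pi0.
  by rewrite /v; field; rewrite gt_eqF.
rewrite e2 lerD2l -(ler_pM2l s0).
move: key; rewrite e1 -sden => h.
have -> : s * (s * (1 + 2 * M ^+ 2)) = s ^+ 2 + 2 * (s * M) ^+ 2 by ring.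
lra.
Qed.

(** The minimax principle behind the t-entropy.  At a near maximizer y of
    sum p_i ln y_i, the first-order condition says that the linear form with
    coefficients p_i / y_i is at most about 1 on K; the hypothesis on K applied
    to this form is then exactly the lower bound for sum p_i ln (y_i / p_i). *)
Lemma entropy_duality e : 0 < e -> exists x,
  [/\ K x, forall i, 0 < p i -> 0 < x i & c - e <= \sum_i p i * ln (x i / p i)].
Proof.
move=> e0; have [x0 Kx0 x0P] := K_pos.
pose d : R := Num.min (e / 5) (2^-1).
have d0 : 0 < d by rewrite lt_min; apply/andP; split; lra.
have de : 5 * d <= e.
  have : d <= e / 5 by rewrite ge_min lexx.
  lra.
have dh : d <= 2^-1 by rewrite ge_min lexx orbT.
(* staying above d * x0 keeps the logarithms away from their singularity, at
   the price of a factor 1 - d in the first-order condition *)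
pose K' := [set x | K x /\ forall i, d * x0 i <= x i].
pose M := \sum_i B / (d * x0 i).
have x0ge0 i : 0 <= x0 i by exact: K_ge0.
have [||||||y [Ky yx0] yP] := @near_maximizer K' x0 d M.
- by split=> // i; rewrite ler_piMl//; lra.
- by move=> x [].
- move=> x y s [Kx xP] [Ky yP] /andP[s0 s1]; split.
    by apply: K_convex => //; rewrite s0.
  move=> i; have -> : d * x0 i = (1 - s) * (d * x0 i) + s * (d * x0 i) by ring.
  by rewrite lerD// ler_wpM2l// subr_ge0.
- by move=> x i [Kx xP] pi0; rewrite (lt_le_trans _ (xP i))// mulr_gt0// x0P.
- move=> x y i [Kx xP] [Ky _] pi0.
  have a0 : 0 < d * x0 i by rewrite mulr_gt0// x0P.
  have xi0 : 0 < x i by apply: lt_le_trans (xP i).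
  rewrite normrM (ger0_norm (_ : 0 <= (x i)^-1)) ?invr_ge0 ?(ltW xi0)//.
  apply: (@le_trans _ _ (B / (d * x0 i))).
    apply: ler_pM => //; first by rewrite invr_ge0 ltW.
      have := K_ge0 i Kx; have := K_ge0 i Ky.
      have := K_leB i Kx; have := K_leB i Ky.
      by rewrite ler_norml => *; apply/andP; split; lra.
    by rewrite lef_pV2 ?posrE.
  rewrite /M (bigD1 i)//= lerDl sumr_ge0// => j _.
  by rewrite divr_ge0// mulr_ge0// ltW.
- by rewrite d0/=; lra.
have ypos i : 0 < p i -> 0 < y i.
  by move=> pi0; rewrite (lt_le_trans _ (yx0 i))// mulr_gt0// x0P.
exists y; split => //.
(* coordinates of weight 0 need a positive coefficient too; eta is so small that
   together they contribute at most d *)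
pose eta := d / (#|I|%:R * B + 1).
have IB0 : 0 <= #|I|%:R * B by rewrite mulr_ge0.
have eta0 : 0 < eta by rewrite divr_gt0//; lra.
pose t i := if 0 < p i then ln (p i / y i) else ln eta.
have tsum : \sum_i p i * t i = - \sum_i p i * ln (y i / p i).
  rewrite -sumrN; apply: eq_bigr => i _.
  have := p_ge0 i; rewrite le_eqVlt => /predU1P[<-|pi0].
    by rewrite !mul0r oppr0.
  rewrite /t pi0 -invf_div lnV ?posrE ?divr_gt0// ?ypos//.
  by rewrite mulrN.
have : expR (c + \sum_i p i * t i) <= 1 + 5 * d.
  apply: K_dual => x Kx.
  have h1 : (1 - d) * \sum_i p i * (x i / y i) <= 1 + d.
    have /yP : K' (fun i => (1 - d) * x i + d * x0 i).
      split; first by apply: K_convex => //; apply/andP; split; lra.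
      by move=> i; rewrite lerDr mulr_ge0 ?K_ge0//; lra.
    apply: le_trans; rewrite mulr_sumr; apply: ler_sum => i _.
    rewrite mulrCA ler_wpM2l// mulrA ler_wpM2r ?invr_ge0 ?K_ge0//.
    by rewrite lerDl mulr_ge0// ltW.
  have h2 : \sum_i expR (t i) * x i <= \sum_i p i * (x i / y i) + d.
    apply: (@le_trans _ _ (\sum_i (p i * (x i / y i) + eta * B))).
      apply: ler_sum => i _; rewrite /t; case: ifPn => [pi0|].
        rewrite lnK ?posrE ?divr_gt0 ?ypos//.
        rewrite [X in X + _](_ : _ = p i / y i * x i); last by rewrite mulrAC mulrA.
        by rewrite lerDl mulr_ge0// ltW.
      rewrite -leNgt => pi0; have -> : p i = 0 by apply/le_anti; rewrite pi0 p_ge0.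
      by rewrite mul0r add0r lnK ?posrE// ler_wpM2l ?K_leB// ltW.
    rewrite big_split/= lerD2l sumr_const -mulr_natl mulrCA /eta -mulrA.
    by rewrite ger_pMr// mulrC ler_pdivrMr; lra.
  apply: (le_trans h2).
  have S0 : 0 <= \sum_i p i * (x i / y i).
    by apply: sumr_ge0 => i _; rewrite mulr_ge0// divr_ge0// K_ge0.
  nra.
rewrite tsum => h.
have : expR (c - \sum_i p i * ln (y i / p i)) <= expR e.
  apply: (le_trans h); apply: (le_trans (expR_ge1Dx _)).
  by rewrite ler_expR.
rewrite ler_expR; lra.
Qed.

End entropy_duality.

(** Weighted arithmetic-geometric mean inequality for e^(p - a) and e^(q - b),
    multiplied by e^c. *)
Lemma expR_weighted_le (R : realType) (s a b c p q : R) : 0 <= s <= 1 ->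
  c = s * a + (1 - s) * b ->
  expR (s * p + (1 - s) * q) <=
    s * expR (c - a) * expR p + (1 - s) * expR (c - b) * expR q.
Proof.
move=> /andP[s0 s1] cE; rewrite -(mulrA s) -(mulrA (1 - s)) -2!expRD.
have := @convex_expR R (Itv01 s0 s1) (c - a + p) (c - b + q).
rewrite !convRE/= -[unstable.onem s]/(1 - s).
suff -> : s * (c - a + p) + (1 - s) * (c - b + q) = s * p + (1 - s) * q by [].
by rewrite cE; ring.
Qed.

(** Jensen's inequality: bound each e^(t_i) from below by the tangent line of exp
    at the mean. *)
Lemma expR_sum_le (R : realType) (I : finType) (w t : I -> R) :
  (forall i, 0 <= w i) -> \sum_i w i = 1 ->
  expR (\sum_i w i * t i) <= \sum_i expR (t i) * w i.
Proof.
move=> w0 w1; set a := \sum_i w i * t i.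
have -> : expR a = \sum_i expR a * ((1 - a) * w i + w i * t i).
  by rewrite -mulr_sumr big_split/= -mulr_sumr w1 -/a mulr1 subrK mulr1.
apply: ler_sum => i _.
have -> : expR (t i) = expR a * expR (t i - a) by rewrite -expRD addrC subrK.
rewrite -mulrA ler_wpM2l ?expR_ge0//.
have -> : (1 - a) * w i + w i * t i = (1 + (t i - a)) * w i by ring.
by rewrite ler_wpM2r// expR_ge1Dx.
Qed.

Lemma expR_weighted_eq (R : realType) (s a b c : R) :
  s * expR (c - a) * expR a + (1 - s) * expR (c - b) * expR b = expR c.
Proof.
rewrite -(mulrA s) -(mulrA (1 - s)) -(expRD (c - a)) -(expRD (c - b)) !subrK.
by rewrite -mulrDl addrC subrK mul1r.
Qed.

(** * Integrals of moduli against bounded weights *)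

Section weighted_norm.
Context (R : realType) d (X : measurableType d) (m : {measure set X -> \bar R}).
Implicit Types (g : Linfty m) (h f : L1 m).

Lemma Linfty_bounded g : exists M : R, {ae m, forall x, `|g x| <= M}.
Proof.
have : finite_norm m +oo g by exact: Lfunction_finite.
rewrite /finite_norm unlock/=; case: ifPn => [m0 gfin|m0 _]; last first.
  exists 0, setT; split => //; apply/le_anti; rewrite measure_ge0 andbT.
  by rewrite leNgt.
have h0 : (0 <= ess_sup m (abse \o (EFin \o g)))%E.
  by apply: ess_sup_gee => //; apply: aeW => x /=.
exists (fine (ess_sup m (abse \o (EFin \o g)))).
apply: filterS (ess_sup_ge m (abse \o (EFin \o g))) => x /=.
by rewrite -lee_fin fineK// ge0_fin_numE.
Qed.

Lemma bounded_Linfty (u : X -> R) M : measurable_fun setT u ->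
  {ae m, forall x, `|u x| <= M} -> u \in Lfun m +oo.
Proof.
move=> mu uM; rewrite inE; apply/andP; split; rewrite inE//=.
rewrite /finite_norm unlock/=; case: ifPn => // _.
apply: (@le_lt_trans _ _ M%:E); last exact: ltry.
by apply: ereal_inf_lbound => /=; apply: filterS uM => x /=; rewrite lee_fin.
Qed.

Lemma integrable_L1 f : m.-integrable setT (EFin \o f).
Proof.
apply/integrableP; split; first by apply/measurable_EFinP.
have : finite_norm m 1 f by exact: Lfunction_finite.
by rewrite /finite_norm Lnorm1.
Qed.

Lemma integrable_Lfun1 (u : X -> R) :
  m.-integrable setT (EFin \o u) -> u \in Lfun m 1.
Proof.
move=> /integrableP[mu iu]; rewrite inE; apply/andP; split; rewrite inE/=.
  exact/measurable_EFinP.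
by rewrite /finite_norm Lnorm1.
Qed.

Lemma integrable_wnorm g h : m.-integrable setT (fun x => (g x * `|h x|)%:E).
Proof.
have mgh : measurable_fun setT (fun x => g x * `|h x|).
  by apply: measurable_funM => //; exact: measurableT_comp.
apply/integrableP; split; first exact/measurable_EFinP.
have [M gM] := Linfty_bounded g.
have ih := integrable_L1 h.
apply: (@le_lt_trans _ _ (\int[m]_x ((`|M|)%:E * `|(h x)%:E|))%E).
  apply: ae_ge0_le_integral => //.
  - by apply/measurableT_comp => //; exact/measurable_EFinP.
  - by apply/measurable_EFinP; apply: measurable_funM => //; exact: measurableT_comp.
  - apply: filterS gM => x gxM _ /=; rewrite lee_fin normrM normr_id ler_wpM2r//.
    exact: le_trans gxM (ler_norm _).
rewrite ge0_integralZl//; last by apply/measurable_EFinP; exact: measurableT_comp.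
rewrite lte_mul_pinfty//.
by have /integrableP[] := ih.
Qed.

(** The L^1 norm of h with the weight g; it is linear in g, also when g takes
    negative values. *)
Definition wnorm g h : R := (\int[m]_x (g x * `|h x|))%R.

Lemma wnormE g h : (\int[m]_x (g x * `|h x|)%:E)%E = (wnorm g h)%:E.
Proof.
rewrite /wnorm /Rintegral fineK//.
by apply: integrable_fin_num => //; exact: integrable_wnorm.
Qed.

Lemma wnormZD a g1 g2 h : wnorm (a *: g1 + g2) h = a * wnorm g1 h + wnorm g2 h.
Proof.
rewrite /wnorm; under [LHS]eq_Rintegral.
  move=> x _; have -> : (a *: g1 + g2) x * `|h x| =
    a * (g1 x * `|h x|) + g2 x * `|h x| by rewrite mulrA -mulrDl.
  over.
rewrite RintegralD//; [|exact: (integrableZl measurableT _ (integrable_wnorm g1 h))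
  |exact: integrable_wnorm].
by rewrite RintegralZl//; exact: integrable_wnorm.
Qed.

Lemma wnorm0 h : wnorm 0 h = 0.
Proof. by have := wnormZD (-1) 0 0 h; rewrite scaler0 addr0; lra. Qed.

Lemma wnormD g1 g2 h : wnorm (g1 + g2) h = wnorm g1 h + wnorm g2 h.
Proof. by rewrite -[g1]scale1r wnormZD scale1r mul1r. Qed.

Lemma wnormZ a g h : wnorm (a *: g) h = a * wnorm g h.
Proof. by rewrite -[a *: g]addr0 wnormZD wnorm0 addr0. Qed.

Lemma wnorm_sum (I : Type) (r : seq I) (G : I -> Linfty m) h :
  wnorm (\sum_(i <- r) G i) h = \sum_(i <- r) wnorm (G i) h.
Proof. by apply: (big_morph (fun g => wnorm g h)) => [x y|]; rewrite ?wnormD ?wnorm0. Qed.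

Lemma wnorm_ge0 g h : {ae m, forall x, 0 <= g x} -> 0 <= wnorm g h.
Proof.
move=> g0; rewrite -lee_fin -wnormE.
have mgh : measurable_fun setT (fun x => g x * `|h x|).
  by apply: measurable_funM => //; exact: measurableT_comp.
rewrite (ae_eq_integral (fun x => `|g x * `|h x| |%:E)) //.
- by apply: integral_ge0 => x _.
- exact/measurable_EFinP.
- by apply/measurable_EFinP; exact: measurableT_comp.
- by apply: filterS g0 => x gx0 _; congr EFin; rewrite [RHS]ger0_norm//; exact: mulr_ge0.
Qed.

Lemma le_wnorm g1 g2 h : {ae m, forall x, g1 x <= g2 x} -> wnorm g1 h <= wnorm g2 h.
Proof.
move=> g12; rewrite -subr_ge0 -mulN1r addrC -wnormZD; apply: wnorm_ge0.
apply: filterS g12 => x gx.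
by change (0 <= -1 * g1 x + g2 x); lra.
Qed.

Definition L1norm h : R := wnorm (Linfty1 m) h.

Lemma Lnorm1E h : 'N[m]_1[EFin \o h]%E = (L1norm h)%:E.
Proof.
rewrite Lnorm1 /L1norm -wnormE; apply: eq_integral => x _ /=.
by rewrite mul1r.
Qed.

Lemma L1norm_ge0 h : 0 <= L1norm h.
Proof. by apply: wnorm_ge0; apply: aeW => x /=. Qed.

Lemma L1_weight_subproof g h : (fun x => g x * `|h x|) \in Lfun m 1.
Proof. exact: integrable_Lfun1 (integrable_wnorm g h). Qed.

(** The modulus of h is taken so that, for g >= 0, the norm of the result is
    wnorm g h. *)
Definition L1_weight g h : L1 m := Lfun_Sub (lexx 1%E) (L1_weight_subproof g h).

(** The values wnorm g f depend on |f| only; this is what makes the set of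
    vectors of weighted norms of unit functions convex. *)
Lemma L1_convex_abs (s : R) f1 f2 : 0 <= s <= 1 -> exists f : L1 m,
  (forall x, `|f x| = (1 - s) * `|f1 x| + s * `|f2 x|).
Proof.
move=> /andP[s0 s1].
exists ((1 - s) *: L1_weight (Linfty1 m) f1 + s *: L1_weight (Linfty1 m) f2) => x.
change (`|(1 - s) * (1 * `|f1 x|) + s * (1 * `|f2 x|)| = 
  (1 - s) * `|f1 x| + s * `|f2 x|).
by rewrite !mul1r ger0_norm// addr_ge0// mulr_ge0// subr_ge0.
Qed.

End weighted_norm.

(** * The shift and the pressure *)

Section shift.
Context (R : realType) d (X : measurableType d) (m : {measure set X -> \bar R}).
Variables (alpha : {mfun X >-> X}) (hA : shift_bounded m alpha).
Implicit Types (g psi chi : Linfty m) (h f : L1 m).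

Local Notation T := (Linfty_shift hA).

Lemma ae_shift (n : nat) (Q : X -> Prop) : {ae m, forall x, Q x} ->
  {ae m, forall x, Q (iter n alpha x)}.
Proof.
elim: n Q => // n IH Q /IH [N [mN N0 QN]].
exists (alpha @^-1` N); split.
  by rewrite -[X in measurable X]setTI; exact: measurable_funPT.
  exact: shift_bounded_null.
by move=> x /= Qx; apply: QN => /=; rewrite -iterSr.
Qed.

Lemma Linfty_shiftE n psi x : iter n T psi x = psi (iter n alpha x).
Proof. by elim: n x => // n IH x; rewrite [LHS]/= IH -iterSr. Qed.

Lemma L1_shift_subproof f : f \o alpha \in Lfun m 1.
Proof.
rewrite inE; apply/andP; split; rewrite inE/=; first exact: measurableT_comp.
have [C hC] := hA; apply: (le_lt_trans (hC f)).
by rewrite Lnorm1E -EFinM ltry.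
Qed.

Definition L1_shift f : L1 m := Lfun_Sub (lexx 1%E) (L1_shift_subproof f).

Lemma L1_shiftE n f x : iter n L1_shift f x = f (iter n alpha x).
Proof. by elim: n x => // n IH x; rewrite [LHS]/= IH -iterSr. Qed.

Lemma L1norm_shift_le : exists2 C : R, 0 <= C & forall n f,
  L1norm (iter n L1_shift f) <= C ^+ n * L1norm f.
Proof.
have [C hC] := hA; exists `|C| => //; elim=> [|n IH] f.
  by rewrite expr0 mul1r.
have := hC (iter n L1_shift f).
rewrite -[EFin \o (_ \o alpha)]/(EFin \o iter n.+1 L1_shift f) !Lnorm1E.
rewrite lee_fin => /le_trans; apply.
apply: (@le_trans _ _ (`|C| * L1norm (iter n L1_shift f))).
  by rewrite ler_wpM2r ?L1norm_ge0// ler_norm.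
by rewrite exprS -mulrA ler_wpM2l.
Qed.

Lemma Linfty_exp_subproof psi : (fun x => expR (psi x)) \in Lfun m +oo.
Proof.
have [M psiM] := Linfty_bounded psi.
apply: (@bounded_Linfty _ _ _ _ _ (expR M)); first exact: measurableT_comp.
apply: filterS psiM => x psixM; rewrite ger0_norm ?expR_ge0// ler_expR.
exact: le_trans (ler_norm _) psixM.
Qed.

Definition Linfty_exp psi : Linfty m := Lfun_Sub (leey 1%E) (Linfty_exp_subproof psi).

Definition Birkhoff_sum (n : nat) psi : Linfty m := \sum_(k < n) iter k T psi.

(** The logarithm of the norm on L^1 of f |-> e^psi (f o alpha^n). *)
Definition pressure (n : nat) psi : R :=
  ln (fine (L1_opnorm m (fun u x => expR (psi x) * u (iter n alpha x)))).

Lemma opnormE n psi : L1_opnorm m (fun u x => expR (psi x) * u (iter n alpha x)) =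
  ereal_sup [set (wnorm (Linfty_exp psi) (iter n L1_shift f))%:E |
    f in [set f : L1 m | L1norm f <= 1]].
Proof.
rewrite /L1_opnorm; congr (ereal_sup (_ @` _)).
  by apply/funext => f /=; rewrite Lnorm1E lee_fin.
apply/funext => f; rewrite /= Lnorm1 -wnormE; apply: eq_integral => x _ /=.
by rewrite normrM (ger0_norm (expR_ge0 _)) L1_shiftE.
Qed.

Lemma wnorm_exp_bounded n psi : exists2 C : R, 0 <= C & forall f,
  wnorm (Linfty_exp psi) (iter n L1_shift f) <= C * L1norm f.
Proof.
have [C C0 hC] := L1norm_shift_le.
have [M psiM] := Linfty_bounded psi.
exists (expR M * C ^+ n); first by rewrite mulr_ge0 ?expR_ge0 ?exprn_ge0.
move=> f; apply: (@le_trans _ _ (expR M * L1norm (iter n L1_shift f))).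
  rewrite /L1norm -wnormZ; apply: le_wnorm; apply: filterS psiM => x psixM.
  change (expR (psi x) <= expR M * 1); rewrite mulr1 ler_expR.
  exact: le_trans (ler_norm _) psixM.
by rewrite -mulrA ler_wpM2l ?expR_ge0.
Qed.

Lemma wnormZr g a f f' : (forall x, `|f' x| = a * `|f x|) -> wnorm g f' = a * wnorm g f.
Proof.
move=> ff'; rewrite -wnormZ; apply: eq_Rintegral => x _.
by rewrite ff' mulrCA mulrA.
Qed.

Lemma L1normZr a f f' : (forall x, `|f' x| = a * `|f x|) -> L1norm f' = a * L1norm f.
Proof. exact: wnormZr. Qed.

Lemma wnorm_cvx g (s : R) f1 f2 f :
  (forall x, `|f x| = (1 - s) * `|f1 x| + s * `|f2 x|) ->
  (1 - s) * wnorm g f1 + s * wnorm g f2 = wnorm g f.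
Proof.
move=> fE; rewrite -!wnormZ.
have -> : wnorm g f = \int[m]_x (((1 - s) *: g) x * `|f1 x| + (s *: g) x * `|f2 x|).
  apply: eq_Rintegral => x _; rewrite fE.
  change (g x * ((1 - s) * `|f1 x| + s * `|f2 x|) =
    (1 - s) * g x * `|f1 x| + s * g x * `|f2 x|).
  by ring.
by rewrite RintegralD//; exact: integrable_wnorm.
Qed.

Lemma L1norm_cvx (s : R) f1 f2 f :
  (forall x, `|f x| = (1 - s) * `|f1 x| + s * `|f2 x|) ->
  L1norm f = (1 - s) * L1norm f1 + s * L1norm f2.
Proof. by move=> /wnorm_cvx fE; rewrite /L1norm fE. Qed.

Lemma wnorm_exp_gt0 psi f : 0 < L1norm f -> 0 < wnorm (Linfty_exp psi) f.
Proof.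
move=> f0; have [M psiM] := Linfty_bounded psi.
apply: (@lt_le_trans _ _ (expR (- M) * L1norm f)).
  by rewrite mulr_gt0// expR_gt0.
rewrite /L1norm -wnormZ; apply: le_wnorm; apply: filterS psiM => x.
rewrite ler_norml => /andP[psixM _].
by change (expR (- M) * 1 <= expR (psi x)); rewrite mulr1 ler_expR.
Qed.

Lemma L1_normalize f : 0 < L1norm f -> exists f',
  L1norm f' = 1 /\ forall x, `|f' x| = (L1norm f)^-1 * `|f x|.
Proof.
move=> f0; set a := L1norm f in f0 *.
have fa x : `|(a^-1 *: f : L1 m) x| = a^-1 * `|f x|.
  change (`|a^-1 * f x| = a^-1 * `|f x|).
  by rewrite normrM ger0_norm// invr_ge0 ltW.
exists (a^-1 *: f); split => //.
by rewrite (@L1normZr a^-1 f)// mulVf// gt_eqF.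
Qed.

End shift.

Section pressure.
Context (R : realType) d (X : measurableType d).
Variables (m : {sigma_finite_measure set X -> \bar R}) (alpha : {mfun X >-> X}).
Hypotheses (m_neq0 : m setT != 0%E) (hA : shift_bounded m alpha).
Implicit Types (g psi chi : Linfty m) (h f : L1 m).

Local Notation T := (Linfty_shift hA).

(** Let X be covered by countably many sets of finite measure.  Their preimages
    under alpha^n cover X as well, so one of these is not null; the indicator of
    the corresponding set does the job.  Consequently no iterate of a weighted
    shift vanishes and all the pressures are real. *)
Lemma exists_shift_pos n : exists2 f : L1 m, L1norm f = 1 &
  0 < L1norm (iter n (L1_shift hA) f).
Proof.
have [F FT /all_and2[mF Ffin]] := sigma_finiteT m.
have miter (A : set X) : measurable A -> measurable (iter n alpha @^-1` A).
  elim: n A => // k IH A mA; apply: (IH (alpha @^-1` A)).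
  by rewrite -[X in measurable X]setTI; exact: measurable_funPT.
have [i iP] : exists i, (0 < m (iter n alpha @^-1` F i))%E.
  apply: contrapT => /forallNP F0; move/eqP: m_neq0; apply.
  have /negligibleP : m.-negligible (\bigcup_i (iter n alpha @^-1` F i)).
    apply: negligible_bigcup => i; apply/negligibleP; first exact: miter.
    by apply/eqP; rewrite eq_le measure_ge0 andbT leNgt; apply/negP; exact: F0.
  have -> : \bigcup_i (iter n alpha @^-1` F i) = setT.
    by rewrite -preimage_bigcup -FT preimage_setT.
  by apply; exact: measurableT.
have indL A : measurable A -> (m A < +oo)%E -> (\1_A : X -> R) \in Lfun m 1.
  move=> mA Afin; apply: integrable_Lfun1; apply/integrableP; split.
    exact/measurable_EFinP.
  under eq_integral do rewrite /= ger0_norm//.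
  by rewrite integral_indic// setIT.
have mA := miter _ (mF i).
pose f : L1 m := Lfun_Sub (lexx 1%E) (indL _ (mF i) (Ffin i)).
have shf : (L1norm (iter n (L1_shift hA) f))%:E = m (iter n alpha @^-1` F i).
  rewrite /L1norm -wnormE.
  transitivity (\int[m]_x (\1_(iter n alpha @^-1` F i) x)%:E)%E; last first.
    by rewrite integral_indic// setIT.
  apply: eq_integral => x _; rewrite L1_shiftE mul1r.
  change (`|\1_(F i) (iter n alpha x)|%:E = (\1_(F i) (iter n alpha x))%:E :> \bar R).
  by rewrite ger0_norm.
have [C C0 hC] := L1norm_shift_le hA.
have shf0 : 0 < L1norm (iter n (L1_shift hA) f) by rewrite -lte_fin shf.
have f0 : 0 < L1norm f.
  rewrite lt_neqAle L1norm_ge0 andbT eq_sym; apply/eqP => f0.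
  by have := hC n f; rewrite f0 mulr0 leNgt shf0.
have [f' [f'1 f'f]] := L1_normalize f0.
exists f' => //; rewrite (@L1normZr _ _ _ _ (L1norm f)^-1 (iter n (L1_shift hA) f)).
  by rewrite mulr_gt0 ?invr_gt0.
by move=> x; rewrite !L1_shiftE.
Qed.

Lemma opnormP n psi : exists N : R, [/\ 0 < N,
  L1_opnorm m (fun u x => expR (psi x) * u (iter n alpha x)) = N%:E,
  (forall f, wnorm (Linfty_exp psi) (iter n (L1_shift hA) f) <= N * L1norm f) &
  (forall b, (forall f, L1norm f = 1 ->
    wnorm (Linfty_exp psi) (iter n (L1_shift hA) f) <= b) -> N <= b)].
Proof.
set S := L1_opnorm _ _; have SE : S = _ := opnormE hA n psi.
have [C C0 hC] := wnorm_exp_bounded hA n psi.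
have Sub f : L1norm f = 1 ->
    ((wnorm (Linfty_exp psi) (iter n (L1_shift hA) f))%:E <= S)%E.
  by move=> f1; rewrite SE; apply: ereal_sup_ubound; exists f => //=; rewrite f1.
have [f0 f01 f0P] := exists_shift_pos n.
have S0 : (0 < S)%E.
  apply: lt_le_trans (Sub _ f01); rewrite lte_fin.
  exact: wnorm_exp_gt0.
have SC : (S <= C%:E)%E.
  rewrite SE; apply: ge_ereal_sup => _ [f /= f1 <-]; rewrite lee_fin.
  by apply: (le_trans (hC f)); rewrite ler_piMr.
have Sfin : S \is a fin_num by rewrite ge0_fin_numE ?ltW// (le_lt_trans SC) ?ltry.
have NE : S = (fine S)%:E by rewrite fineK.
have hle b : (forall f, L1norm f = 1 ->
    wnorm (Linfty_exp psi) (iter n (L1_shift hA) f) <= b) -> 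
    forall f, wnorm (Linfty_exp psi) (iter n (L1_shift hA) f) <= b * L1norm f.
  move=> hb f; have := L1norm_ge0 f; rewrite le_eqVlt => /predU1P[f0'|fpos].
    by have := hC f; rewrite -f0' !mulr0.
  have [f' [f'1 f'f]] := L1_normalize fpos.
  have := hb f' f'1.
  rewrite (@wnormZr _ _ _ _ _ (L1norm f)^-1 (iter n (L1_shift hA) f)).
    by rewrite ler_pdivrMl// mulrC.
  by move=> x; rewrite !L1_shiftE.
exists (fine S); split=> //.
- by rewrite fine_gt0// S0 (le_lt_trans SC) ?ltry.
- by apply: hle => f f1; rewrite -lee_fin -NE; exact: Sub.
- move=> b hb; rewrite -lee_fin -NE SE; apply: ge_ereal_sup => _ [f /= f1 <-].
  rewrite lee_fin; apply: (le_trans (hle b hb f)).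
  rewrite ler_piMr//; apply: le_trans (hb f0 f01).
  apply: wnorm_ge0; apply: aeW => x; exact: expR_ge0.
Qed.

Lemma opnorm_pressure n psi :
  L1_opnorm m (fun u x => expR (psi x) * u (iter n alpha x)) =
    (expR (pressure alpha n psi))%:E.
Proof.
have [N [N0 NE _ _]] := opnormP n psi.
by rewrite /pressure NE /= lnK ?posrE.
Qed.

(** Together with [pressure_le], this characterizes the pressure. *)
Lemma pressure_ub n psi f : wnorm (Linfty_exp psi) (iter n (L1_shift hA) f) <=
  expR (pressure alpha n psi) * L1norm f.
Proof.
have [N [N0 NE hN _]] := opnormP n psi.
by rewrite /pressure NE /= lnK ?posrE.
Qed.

Lemma pressure_le n psi b : (forall f, L1norm f = 1 ->
  wnorm (Linfty_exp psi) (iter n (L1_shift hA) f) <= expR b) ->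
  pressure alpha n psi <= b.
Proof.
have [N [N0 NE _ hN]] := opnormP n psi.
move=> /hN; rewrite /pressure NE/= -[N in (N <= _) -> _]lnK ?posrE//.
by rewrite ler_expR.
Qed.

(** Submultiplicativity of the norm: the operator with weight
    psi + chi o alpha^n at time n + k is the operator of psi at time n after that
    of chi at time k. *)
Lemma pressure_subadd n k psi chi :
  pressure alpha (n + k) (psi + iter n T chi) <=
  pressure alpha n psi + pressure alpha k chi.
Proof.
apply: pressure_le => f f1.
pose f' := L1_weight (Linfty_exp chi) (iter k (L1_shift hA) f).
have -> : wnorm (Linfty_exp (psi + iter n T chi)) (iter (n + k) (L1_shift hA) f) =
    wnorm (Linfty_exp psi) (iter n (L1_shift hA) f').
  apply: eq_Rintegral => x _; rewrite !L1_shiftE.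
  rewrite [X in _ = _ * X]ger0_norm; last by rewrite mulr_ge0 ?expR_ge0.
  change (expR (psi x + iter n T chi x) * `|f (iter (n + k) alpha x)| =
    expR (psi x) * (expR (chi (iter n alpha x)) *
      `|iter k (L1_shift hA) f (iter n alpha x)|)).
  by rewrite L1_shiftE Linfty_shiftE expRD mulrA addnC iterD.
apply: (le_trans (pressure_ub n psi f')).
rewrite expRD ler_wpM2l ?expR_ge0//.
have -> : L1norm f' = wnorm (Linfty_exp chi) (iter k (L1_shift hA) f).
  apply: eq_Rintegral => x _; rewrite mul1r ger0_norm//.
  by rewrite mulr_ge0 ?expR_ge0.
by have := pressure_ub k chi f; rewrite f1 mulr1.
Qed.

Lemma pressure_le_cst n psi chi c : {ae m, forall x, psi x <= chi x + c} ->
  pressure alpha n psi <= pressure alpha n chi + c.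
Proof.
move=> h; apply: pressure_le => f f1.
rewrite expRD; have := pressure_ub n chi f; rewrite f1 mulr1 => h'.
apply: (@le_trans _ _ (expR c * wnorm (Linfty_exp chi) (iter n (L1_shift hA) f))).
  rewrite -wnormZ; apply: le_wnorm; apply: filterS h => x hx.
  by change (expR (psi x) <= expR c * expR (chi x)); rewrite -expRD ler_expR addrC.
by rewrite mulrC ler_wpM2r ?expR_ge0.
Qed.

(** Log-convexity of the norm in the logarithm of the weight.  After dividing
    the two weights by their norms e^a and e^b, the weighted
    arithmetic-geometric mean inequality holds pointwise, and it can be
    integrated because wnorm is linear in the weight. *)
Lemma pressure_convex n psi chi s : 0 <= s <= 1 ->
  pressure alpha n (s *: psi + (1 - s) *: chi) <=
  s * pressure alpha n psi + (1 - s) * pressure alpha n chi.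
Proof.
move=> /andP[s0 s1]; apply: pressure_le => f f1.
have hb := pressure_ub n chi f; rewrite f1 mulr1 in hb.
have ha := pressure_ub n psi f; rewrite f1 mulr1 in ha.
move: ha hb; move: (pressure alpha n psi) (pressure alpha n chi) => a b ha hb.
have [c cE] : exists c, c = s * a + (1 - s) * b by exists (s * a + (1 - s) * b).
rewrite -cE.
pose w : Linfty m := (s * expR (c - a)) *: Linfty_exp psi +
  ((1 - s) * expR (c - b)) *: Linfty_exp chi.
apply: (@le_trans _ _ (wnorm w (iter n (L1_shift hA) f))).
  apply: le_wnorm; apply: aeW => x.
  change (expR (s * psi x + (1 - s) * chi x) <=
    s * expR (c - a) * expR (psi x) + (1 - s) * expR (c - b) * expR (chi x)).
  by apply: expR_weighted_le => //; rewrite s0.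
rewrite wnormD !wnormZ.
rewrite -(expR_weighted_eq s a b c).
have w1 : 0 <= s * expR (c - a) by rewrite mulr_ge0 ?expR_ge0.
have w2 : 0 <= (1 - s) * expR (c - b) by rewrite mulr_ge0 ?expR_ge0 ?subr_ge0.
by apply: lerD; apply: ler_wpM2l.
Qed.

Lemma pressure_average n (k : nat) (Psi : nat -> Linfty m) L : (0 < k)%N ->
  (forall i, (i < k)%N -> pressure alpha n (Psi i) <= L) ->
  pressure alpha n (k%:R^-1 *: \sum_(i < k) Psi i) <= L.
Proof.
elim: k => // -[_ _ PsiL|k IH _ PsiL].
  by rewrite big_ord_recl big_ord0 addr0 invr1 scale1r PsiL.
pose s : R := k.+1%:R / k.+2%:R.
have s01 : 0 <= s <= 1 by rewrite divr_ge0//= ler_pdivrMr// mul1r ler_nat.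
have -> : k.+2%:R^-1 *: \sum_(i < k.+2) Psi i =
    s *: (k.+1%:R^-1 *: \sum_(i < k.+1) Psi i) + (1 - s) *: Psi k.+1.
  have -> : 1 - s = k.+2%:R^-1.
    by rewrite /s -{1}(@divff _ k.+2%:R) ?pnatr_eq0// -mulrBl -natrB// subSnn mul1r.
  rewrite big_ord_recr/= scalerDr scalerA; congr (_ *: _ + _).
  by rewrite /s mulrAC divff ?pnatr_eq0// mul1r.
apply: (le_trans (pressure_convex _ _ _ s01)).
have -> : L = s * L + (1 - s) * L by ring.
case/andP: s01 => s0 s1.
apply: lerD; apply: ler_wpM2l.
- exact: s0.
- by apply: IH => // i ik; apply: PsiL; exact: ltnW.
- by rewrite subr_ge0.
- exact: PsiL.
Qed.

End pressure.

(** * Limits superior of bounded sequences *)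

Section eventual_sup.
Context (R : realType).
Implicit Types (u : nat -> R) (y : R).

(** The limit superior of u, as the infimum of its eventual upper bounds. *)
Definition eventual_sup u : R := inf [set y | \forall n \near \oo, u n <= y].

Lemma eventual_sup_lbound u b : (\forall n \near \oo, b <= u n) ->
  lbound [set y | \forall n \near \oo, u n <= y] b.
Proof.
move=> bu y /= uy; near \oo => n.
by apply: (@le_trans _ _ (u n)); near: n.
Unshelve. all: by end_near. Qed.

Lemma eventual_sup_le u b y : (\forall n \near \oo, b <= u n) ->
  (\forall n \near \oo, u n <= y) -> eventual_sup u <= y.
Proof. by move=> /eventual_sup_lbound bu uy; apply: ge_inf => //; exists b. Qed.

Lemma eventual_sup_ge u b y : (\forall n \near \oo, b <= u n) ->
  (\forall n \near \oo, u n <= y) -> b <= eventual_sup u.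
Proof.
move=> /eventual_sup_lbound bu uy; apply: lb_le_inf => //.
by exists y.
Qed.

Lemma eventual_sup_lt u b y z : (\forall n \near \oo, b <= u n) ->
  (\forall n \near \oo, u n <= z) ->
  eventual_sup u < y -> \forall n \near \oo, u n <= y.
Proof.
move=> /eventual_sup_lbound bu uz; rewrite -subr_gt0 => uy.
have [|t tP] := @inf_adherent _ [set y | \forall n \near \oo, u n <= y] _ uy.
  by split; [exists z | exists b].
rewrite -/(eventual_sup u) addrC subrK => ty.
by apply: filterS tP => n /le_trans; apply; exact: ltW.
Qed.

Lemma eventual_sup_convex (s : R) u v w b z : 0 <= s <= 1 ->
  (forall n, b <= u n <= z) -> (forall n, b <= v n <= z) ->
  (forall n, b <= w n) -> (forall n, w n <= s * u n + (1 - s) * v n) ->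
  eventual_sup w <= s * eventual_sup u + (1 - s) * eventual_sup v.
Proof.
move=> s01 ub vb wb wle; apply/ler_addgt0Pr => e e0.
have lt (x : nat -> R) : (forall n, b <= x n <= z) ->
    \forall n \near \oo, x n <= eventual_sup x + e.
  move=> xb; apply: (@eventual_sup_lt _ b _ z); last by rewrite ltrDl.
    by apply: nearW => n; have /andP[] := xb n.
  by apply: nearW => n; have /andP[] := xb n.
apply: (@eventual_sup_le _ b); first exact: nearW.
apply: filterS2 (lt _ ub) (lt _ vb) => n.
move: (eventual_sup u) (eventual_sup v) (wle n) => a c wn un vn.
apply: (le_trans wn); case/andP: s01 => s0 s1.
have -> : s * a + (1 - s) * c + e = s * (a + e) + (1 - s) * (c + e) by ring.
by rewrite lerD// ler_wpM2l// subr_ge0.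
Qed.

End eventual_sup.

(** * Birkhoff sums *)

Section birkhoff.
Context (R : realType) d (X : measurableType d).
Variables (m : {measure set X -> \bar R}) (alpha : {mfun X >-> X}).
Hypothesis hA : shift_bounded m alpha.
Implicit Types (f g psi chi : Linfty m).

Local Notation T := (Linfty_shift hA).
Local Notation S := (Birkhoff_sum hA).

Lemma Linfty_sumE (I : Type) (r : seq I) (G : I -> Linfty m) x :
  (\sum_(i <- r) G i) x = \sum_(i <- r) G i x.
Proof. by apply: (big_morph (fun g : Linfty m => g x)). Qed.

Lemma Birkhoff_sumE n psi x : S n psi x = \sum_(k < n) psi (iter k alpha x).
Proof. by rewrite Linfty_sumE; apply: eq_bigr => k _; rewrite Linfty_shiftE. Qed.

Lemma Birkhoff_sum_cocycle n k psi : S (n + k) psi = S n psi + iter n T (S k psi).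
Proof.
apply/LfuneqP => x.
change (S (n + k) psi x = S n psi x + iter n T (S k psi) x).
rewrite Linfty_shiftE !Birkhoff_sumE big_split_ord/=; congr (_ + _).
by apply: eq_bigr => i _; rewrite addnC iterD.
Qed.

Lemma Birkhoff_sum_linear n a f g : S n (a *: f + g) = a *: S n f + S n g.
Proof.
apply/LfuneqP => x.
change (S n (a *: f + g) x = a * S n f x + S n g x).
by rewrite !Birkhoff_sumE mulr_sumr -big_split.
Qed.

Lemma Birkhoff_sum0 n : S n 0 = 0.
Proof.
by have := Birkhoff_sum_linear n (-1) 0 0; rewrite scaler0 addr0 scaleN1r addNr.
Qed.

Lemma Birkhoff_sumD n f g : S n (f + g) = S n f + S n g.
Proof. by have := Birkhoff_sum_linear n 1 f g; rewrite 2!scale1r. Qed.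

Lemma Birkhoff_sumZ n a f : S n (a *: f) = a *: S n f.
Proof. by have := Birkhoff_sum_linear n a f 0; rewrite Birkhoff_sum0 2!addr0. Qed.

Lemma Birkhoff_sum_le n f c : {ae m, forall x, f x <= c} ->
  {ae m, forall x, S n f x <= n%:R * c}.
Proof.
move=> fc; elim: n => [|n IH].
  by apply: aeW => x; rewrite Birkhoff_sumE big_ord0 mul0r.
have fcn := ae_shift hA n fc.
apply: filterS2 IH fcn => x h1 h2.
by move: h1; rewrite !Birkhoff_sumE big_ord_recr/= -natr1 mulrDl mul1r => ?; rewrite lerD.
Qed.

Lemma Birkhoff_sum_coboundary n f x : S n (T f - f) x = f (iter n alpha x) - f x.
Proof.
rewrite Birkhoff_sumE; elim: n => [|n IH]; first by rewrite big_ord0 subrr.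
rewrite big_ord_recr/= IH.
change (f (iter n alpha x) - f x + (f (alpha (iter n alpha x)) - f (iter n alpha x)) =
  f (alpha (iter n alpha x)) - f x).
by ring.
Qed.

End birkhoff.

(** * The growth rate and its subgradients *)

Section variational.
Context (R : realType) d (X : measurableType d).
Variables (m : {sigma_finite_measure set X -> \bar R}) (alpha : {mfun X >-> X}).
Hypotheses (m_neq0 : m setT != 0%E) (hA : shift_bounded m alpha).
Implicit Types (f g psi chi phi : Linfty m).

Local Notation T := (Linfty_shift hA).
Local Notation S := (Birkhoff_sum hA).
Local Notation P := (pressure alpha).

Lemma iter_weighted_shift phi n u x :
  iter n (weighted_shift alpha phi) u x = expR (S n phi x) * u (iter n alpha x).
Proof.
rewrite Birkhoff_sumE; elim: n x => [|n IH] x; first by rewrite big_ord0 expR0 mul1r.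
rewrite iterS {1}/weighted_shift IH mulrA -expRD big_ord_recl -iterSr.
by congr (expR (_ + _) * _); apply: eq_bigr => i _; rewrite -iterSr.
Qed.

Lemma log_norm_seqE phi n : log_norm_seq m alpha phi n = (n%:R^-1 * P n (S n phi))%:E.
Proof.
rewrite /log_norm_seq.
have -> : iter n (weighted_shift alpha phi) =
    fun u x => expR (S n phi x) * u (iter n alpha x).
  by apply/funext => u; apply/funext => x; exact: iter_weighted_shift.
rewrite (opnorm_pressure m_neq0 hA n (S n phi)).
by rewrite lne_EFin ?expR_gt0// expRK -EFinM.
Qed.

Lemma pressure_Birkhoff_subadd phi n k :
  P (n + k) (S (n + k) phi) <= P n (S n phi) + P k (S k phi).
Proof. by rewrite Birkhoff_sum_cocycle; exact: pressure_subadd. Qed.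

Lemma log_norm_seq_cvg phi : log_norm_seq m alpha phi n @[n --> \oo] -->
  ereal_inf [set (n%:R^-1 * P n (S n phi))%:E | n in [set n | (0 < n)%N]].
Proof.
under eq_fun do rewrite log_norm_seqE.
exact: subadditive_cvg (pressure_Birkhoff_subadd phi).
Qed.

Section subgradient.
Variable phi : Linfty m.

(** Comparing with phi at the same time n, rather than with n lambda(phi), keeps
    this bounded in n also when lambda(phi) = -oo. *)
Definition growth_gap psi n : R := n%:R^-1 * (P n (S n (phi + psi)) - P n (S n phi)).

Definition growth_rate psi : R := eventual_sup (growth_gap psi).

Lemma growth_gap_le psi c n : {ae m, forall x, S n psi x <= c} ->
  growth_gap psi n <= n%:R^-1 * c.
Proof.
move=> psic; rewrite ler_wpM2l ?invr_ge0// lerBlDl.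
apply: pressure_le_cst => //; apply: filterS psic => x h.
rewrite Birkhoff_sumD.
change (S n phi x + S n psi x <= S n phi x + c).
  by rewrite lerD2l.
Qed.

(** The Birkhoff sums of psi and of - psi up to time n are at most n M. *)
Lemma growth_gap_bounds psi : exists M : R, forall n,
  - M <= growth_gap psi n <= M.
Proof.
have [M0 psiM0] := Linfty_bounded psi; pose M := `|M0|.
have psiM : {ae m, forall x, `|psi x| <= M}.
  by apply: filterS psiM0 => x /le_trans; apply; exact: ler_norm.
have M_ge0 : 0 <= M by exact: normr_ge0.
have nM (n : nat) : n%:R^-1 * (n%:R * M) <= M.
  case: n => [|n]; first by rewrite mul0r mulr0.
  by rewrite mulrA mulVf ?pnatr_eq0// mul1r.
exists M => n; apply/andP; split; last first.
  apply: le_trans (nM n); apply: growth_gap_le.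
  apply: Birkhoff_sum_le; apply: filterS psiM => x.
  by apply: le_trans; exact: ler_norm.
rewrite -subr_ge0 opprK.
have : P n (S n phi) <= P n (S n (phi + psi)) + n%:R * M.
  apply: pressure_le_cst => //.
  have : {ae m, forall x, (- psi) x <= M}.
    apply: filterS psiM => x; change (`|psi x| <= M -> - psi x <= M).
    by rewrite ler_norml; lra.
  move=> /(Birkhoff_sum_le hA n); apply: filterS => x.
  have -> : S n (phi + psi) = S n phi - S n (- psi).
    by rewrite Birkhoff_sumD -[- psi]scaleN1r Birkhoff_sumZ scaleN1r opprK.
  change (S n (- psi) x <= n%:R * M -> S n phi x <= S n phi x - S n (- psi) x + n%:R * M).
  by lra.
move=> h; apply: (@le_trans _ _ (growth_gap psi n + n%:R^-1 * (n%:R * M))).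
  by rewrite /growth_gap -mulrDr mulr_ge0 ?invr_ge0//; lra.
by rewrite lerD2l.
Qed.

Let gap_ge psi : exists b, \forall n \near \oo, b <= growth_gap psi n.
Proof.
have [M MP] := growth_gap_bounds psi.
by exists (- M); apply: nearW => n; have /andP[] := MP n.
Qed.

Lemma growth_rate_le psi y : (\forall n \near \oo, growth_gap psi n <= y) ->
  growth_rate psi <= y.
Proof. by have [b /eventual_sup_le] := gap_ge psi; apply. Qed.

Lemma growth_rate0 : growth_rate 0 = 0.
Proof.
have g0 n : growth_gap 0 n = 0 by rewrite /growth_gap addr0 subrr mulr0.
apply/le_anti/andP; split.
  by apply: growth_rate_le; apply: nearW => n; rewrite g0.
by apply: (@eventual_sup_ge _ _ 0 0); apply: nearW => n; rewrite g0.
Qed.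

Lemma growth_gap_convex (s : R) psi chi n : 0 <= s <= 1 ->
  growth_gap (s *: psi + (1 - s) *: chi) n <=
  s * growth_gap psi n + (1 - s) * growth_gap chi n.
Proof.
move=> s01; rewrite /growth_gap.
have -> : phi + (s *: psi + (1 - s) *: chi) =
    s *: (phi + psi) + (1 - s) *: (phi + chi).
  by rewrite 2!scalerDr addrACA -scalerDl [s + _]addrC subrK scale1r.
have -> : S n (s *: (phi + psi) + (1 - s) *: (phi + chi)) =
    s *: S n (phi + psi) + (1 - s) *: S n (phi + chi).
  by rewrite Birkhoff_sum_linear Birkhoff_sumZ.
have := pressure_convex m_neq0 hA n (S n (phi + psi)) (S n (phi + chi)) s01.
set a := P n _; set b := P n (S n (phi + psi)); set c := P n (S n (phi + chi)).
set e := P n _ => h.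
rewrite (mulrCA s) (mulrCA (1 - s)) -mulrDr ler_wpM2l ?invr_ge0//; lra.
Qed.

Lemma growth_rate_convex : convex_on growth_rate.
Proof.
move=> s psi chi s01.
have [M1 h1] := growth_gap_bounds psi; have [M2 h2] := growth_gap_bounds chi.
have [M3 h3] := growth_gap_bounds (s *: psi + (1 - s) *: chi).
pose M := Num.max (Num.max M1 M2) M3.
have w (u : nat -> R) M' : M' <= M -> (forall n, - M' <= u n <= M') ->
    forall n, - M <= u n <= M.
  move=> M'M uM n; have /andP[un1 un2] := uM n.
  by rewrite (le_trans un2)// (le_trans _ un1)// lerN2.
apply: (@eventual_sup_convex _ _ _ _ _ (- M) M) => //.
- by apply: w h1; rewrite !le_max lexx.
- by apply: w h2; rewrite !le_max lexx orbT.
- have h n : - M <= growth_gap (s *: psi + (1 - s) *: chi) n <= M.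
    by move: n; apply: w h3; rewrite !le_max lexx orbT.
  by move=> n; have /andP[] := h n.
- by move=> n; exact: growth_gap_convex.
Qed.

Lemma growth_rate_bounded_sums psi c :
  (forall n, {ae m, forall x, S n psi x <= c}) -> growth_rate psi <= 0.
Proof.
move=> psic; apply/ler_addgt0Pr => e e0; rewrite add0r.
apply: growth_rate_le.
exists (Num.truncn (`|c| / e)).+1 => // n /= hn.
apply: (le_trans (growth_gap_le (psic n))).
have n0 : (0 < n)%N by exact: leq_trans hn.
rewrite ler_pdivrMl ?ltr0n//; apply: (le_trans (ler_norm c)).
rewrite -ler_pdivrMr//; apply: ltW; apply: (lt_le_trans (truncnS_gt _)).
by rewrite ler_nat.
Qed.

Lemma growth_rate_ub psi c : {ae m, forall x, psi x <= c} -> growth_rate psi <= c.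
Proof.
move=> psic; apply: growth_rate_le; exists 1%N => // n /= n0.
have := growth_gap_le (Birkhoff_sum_le hA n psic).
by rewrite mulrA mulVf ?mul1r// pnatr_eq0 -lt0n.
Qed.

(** The growth rate is at most sup psi, which applied to - psi with psi >= 0
    gives positivity and applied to 1 and - 1 gives the normalization.  The
    coboundaries psi o alpha - psi and their opposites have bounded Birkhoff sums,
    hence growth rate at most 0, which gives the invariance. *)
Lemma subgradient_invariant (g : {scalar Linfty m}) :
  (forall psi, g psi <= growth_rate psi) -> invariant_states hA g.
Proof.
move=> gle.
have pos psi : {ae m, forall x, 0 <= psi x} -> 0 <= g psi.
  move=> psi0; rewrite -oppr_le0 -linearN/=; apply: (le_trans (gle _)).
  apply: growth_rate_ub; apply: filterS psi0 => x h.
  by change (- psi x <= 0); rewrite oppr_le0.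
have mono psi chi : {ae m, forall x, psi x <= chi x} -> g psi <= g chi.
  move=> h; rewrite -subr_ge0 -linearB/=; apply: pos; apply: filterS h => x h.
  by change (0 <= chi x - psi x); rewrite subr_ge0.
split; first split => //.
- move=> psi chi e; apply/le_anti; rewrite !mono//.
  + by apply: filterS e => x /(_ I) ->.
  + by apply: filterS e => x /(_ I) ->.
- apply/le_anti/andP; split.
    by apply: (le_trans (gle _)); apply: growth_rate_ub; apply: aeW => x /=.
  rewrite -lerN2 -linearN/=; apply: (le_trans (gle _)); apply: growth_rate_ub.
  by apply: aeW => x /=.
- move=> psi; have [M psiM] := Linfty_bounded psi.
  have bd n : {ae m, forall x, `|psi (iter n alpha x) - psi x| <= M + M}.
    have h := ae_shift hA n psiM.
    by apply: filterS2 psiM h => x; rewrite !ler_norml; lra.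
  apply/le_anti/andP; split; rewrite -subr_le0 -linearB/=;
      apply: (le_trans (gle _)); apply: (@growth_rate_bounded_sums _ (M + M)) => n.
    apply: filterS (bd n) => x; rewrite Birkhoff_sum_coboundary.
    by apply: le_trans; exact: ler_norm.
  apply: filterS (bd n) => x.
  have -> : psi - T psi = T (- psi) - (- psi) by apply/LfuneqP => y;
    change (psi y - psi (alpha y) = - psi (alpha y) - - psi y); ring.
  rewrite Birkhoff_sum_coboundary; apply: le_trans.
  change (- psi (iter n alpha x) - - psi x <= `|psi (iter n alpha x) - psi x|).
  by rewrite -normrN; apply: le_trans (ler_norm _); lra.
Qed.

End subgradient.

Lemma pressure0_le0 : P 0 (0 : Linfty m) <= 0.
Proof.
apply: (@pressure_le _ _ _ m alpha m_neq0 hA) => f f1.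
rewrite expR0 -[leRHS]f1; apply: le_wnorm; apply: aeW => x.
by change (expR 0 <= 1 :> R); rewrite expR0.
Qed.

(** The Birkhoff sum of Psi for alpha^k. *)
Definition stride_sum (k j : nat) Psi : Linfty m := \sum_(l < j) iter (k * l) T Psi.

Lemma stride_sumE k j Psi x :
  stride_sum k j Psi x = \sum_(l < j) Psi (iter (k * l) alpha x).
Proof. by rewrite Linfty_sumE; apply: eq_bigr => l _; rewrite Linfty_shiftE. Qed.

Lemma pressure_stride k j Psi : P (k * j) (stride_sum k j Psi) <= j%:R * P k Psi.
Proof.
elim: j => [|j IH]; first by rewrite muln0 /stride_sum big_ord0 mul0r pressure0_le0.
have -> : stride_sum k j.+1 Psi = Psi + iter k T (stride_sum k j Psi).
  apply/LfuneqP => x; rewrite stride_sumE big_ord_recl muln0.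
  change (Psi x + \sum_(i < j) Psi (iter (k * i.+1) alpha x) =
    Psi x + iter k T (stride_sum k j Psi) x).
  rewrite Linfty_shiftE stride_sumE; congr (_ + _); apply: eq_bigr => i _.
  by rewrite mulnS addnC iterD.
rewrite mulnS.
apply: (le_trans (pressure_subadd m_neq0 hA k (k * j) Psi (stride_sum k j Psi))).
move: IH; rewrite -natr1 mulrDl mul1r addrC.
by rewrite lerD2r.
Qed.

(** Sort the times 0, ..., k j - 1 by their residues modulo k. *)
Lemma Birkhoff_sum_stride k j Psi : S (k * j) Psi =
  \sum_(i < k) iter i T (stride_sum k j Psi).
Proof.
apply/LfuneqP => x; rewrite Birkhoff_sumE Linfty_sumE.
rewrite [RHS](eq_bigr (fun i : 'I_k =>
    \sum_(l < j) Psi (iter (k * l) alpha (iter i alpha x)))); last first.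
  by move=> i _; rewrite Linfty_shiftE stride_sumE.
rewrite exchange_big/=; elim: j => [|j IH]; first by rewrite muln0 !big_ord0.
rewrite big_ord_recr/= -IH mulnSr big_split_ord/=; congr (_ + _).
by apply: eq_bigr => i _; rewrite -iterD.
Qed.

(** By [Birkhoff_sum_stride] the Birkhoff sum of Psi / k is the average over
    i < k of the stride sums shifted by alpha^i, and convexity bounds the pressure
    of the average by the largest of their pressures.  The shift by alpha^i costs
    only the norms of alpha^i and alpha^(k - i) and one summand of Psi, all
    bounded independently of j. *)
Lemma pressure_block k Psi : (0 < k)%N -> exists C : R, forall j,
  P (k * j.+1) (S (k * j.+1) (k%:R^-1 *: Psi)) <= j%:R * P k Psi + C.
Proof.
move=> k0; have [M PsiM] := Linfty_bounded Psi.
pose c0 := \sum_(i < k.+1) `|P i (0 : Linfty m)|.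
have c0P i : (i <= k)%N -> P i (0 : Linfty m) <= c0.
  move=> ik; apply: (le_trans (ler_norm _)).
  by rewrite /c0 (bigD1 (Ordinal (ik : i < k.+1)%N))//= lerDl sumr_ge0.
exists (c0 + c0 + M) => j.
rewrite Birkhoff_sumZ Birkhoff_sum_stride.
apply: (@pressure_average _ _ _ m alpha m_neq0 hA _ _
  (fun i => iter i T (stride_sum k j.+1 Psi))) => // i ik.
have -> : (k * j.+1 = i + (k * j + (k - i)))%N.
  by rewrite addnCA subnKC ?(ltnW ik)// mulnSr.
(* the last summand, at time k j + i, is bounded by M; the others fit into the
   decomposition of the time as i + k j + (k - i), with weight 0 in the first and
   last blocks *)
pose h : Linfty m := stride_sum k j Psi + iter (k * j) T (0 : Linfty m).
apply: (@le_trans _ _ (P (i + (k * j + (k - i))) (0 + iter i T h) + M)).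
  apply: (pressure_le_cst m_neq0 hA).
  apply: filterS (ae_shift hA (k * j + i) PsiM) => x.
  rewrite ler_norml => /andP[_ PM].
  change (iter i T (stride_sum k j.+1 Psi) x <= 0 + iter i T h x + M).
  rewrite !Linfty_shiftE.
  change (stride_sum k j.+1 Psi (iter i alpha x) <= 
    0 + (stride_sum k j Psi (iter i alpha x) + iter (k * j) T 0 (iter i alpha x)) + M).
  rewrite Linfty_shiftE !stride_sumE big_ord_recr/= -iterD.
  change (\sum_(i0 < j) Psi (iter (k * i0) alpha (iter i alpha x)) +
    Psi (iter (k * j + i) alpha x) <=
    0 + (\sum_(l < j) Psi (iter (k * l) alpha (iter i alpha x)) + 0) + M).
  by rewrite add0r addr0 lerD2l.
have h1 := pressure_subadd m_neq0 hA i (k * j + (k - i)) 0 h.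
have h2 := pressure_subadd m_neq0 hA (k * j) (k - i) (stride_sum k j Psi) 0.
have h3 := pressure_stride k j Psi.
have h4 := c0P _ (ltnW ik). have h5 := c0P _ (leq_subr i k).
move: h1 h2 h3 h4 h5; rewrite -/h.
move: (P (i + _) _) (P (k * j + _) _) (P i (0 : Linfty m)) (P (k - i) (0 : Linfty m))
  (P (k * j) _) (j%:R * P k _)
  => a1 a2 a3 a4 a5 a6.
lra.
Qed.

(** In other words lambda(Psi / k) <= P k Psi / k.  By subadditivity it suffices
    to bound the pressure at a single time k (j + 1), and the constant of
    [pressure_block] is negligible for large j. *)
Lemma pressure_average_growth k Psi y : (0 < k)%N -> P k Psi < k%:R * y ->
  \forall n \near \oo, P n (S n (k%:R^-1 *: Psi)) <= n%:R * y.
Proof.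
move=> k0 Py; have [C CP] := pressure_block Psi k0.
have e0 : 0 < k%:R * y - P k Psi by rewrite subr_gt0.
have [j jP] : exists j : nat, (C - k%:R * y) / (k%:R * y - P k Psi) < j%:R.
  exists (Num.truncn (`|(C - k%:R * y) / (k%:R * y - P k Psi)|)).+1.
  by rewrite (le_lt_trans (ler_norm _))// truncnS_gt.
apply: (@subadditive_eventually_le _ _ (k * j.+1)).
- exact: pressure_Birkhoff_subadd.
- by rewrite muln_gt0 k0.
- apply: (le_lt_trans (CP j)); move: jP e0 {Py CP}.
  rewrite natrM -natr1; move: (P k Psi) (k%:R : R) (j%:R : R) => p a b + e0.
  by rewrite ltr_pdivrMr//; nra.
Qed.

(** The subgradient inequality at Psi / k - phi, combined with
    lambda(Psi / k) <= P k Psi / k. *)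
Lemma subgradient_le_pressure phi (g : {scalar Linfty m}) (l : R) :
  (forall psi, g psi <= growth_rate phi psi) ->
  (forall n, (0 < n)%N -> n%:R * l <= P n (S n phi)) ->
  forall k Psi, (0 < k)%N -> k%:R * (l - g phi) + g Psi <= P k Psi.
Proof.
move=> gle lle k Psi k0; have k0R : 0 < k%:R :> R by rewrite ltr0n.
apply/ler_addgt0Pr => e e0.
pose y := k%:R^-1 * (P k Psi + e).
have ky : k%:R * y = P k Psi + e by rewrite mulrA mulfV ?mul1r// gt_eqF.
have /(pressure_average_growth k0) hy : P k Psi < k%:R * y by rewrite ky ltrDl.
have : g (k%:R^-1 *: Psi - phi) <= y - l.
  apply: (le_trans (gle _)); apply: growth_rate_le.
  have h1 : \forall n \near \oo, (0 < n)%N by exists 1%N.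
  apply: filterS2 hy h1 => n hn n0.
  rewrite /growth_gap [phi + _]addrC subrK ler_pdivrMl ?ltr0n// mulrBr.
  by apply: lerB => //; exact: lle.
rewrite linearB linearZ/= => h.
have : k%:R * (k%:R^-1 * g Psi - g phi) <= k%:R * (y - l) by rewrite ler_pM2l.
rewrite mulrBr mulrA mulfV ?gt_eqF// mul1r mulrBr ky mulrBr.
move: (k%:R * g phi) (k%:R * l) (P k Psi) (g Psi) => a b c q; lra.
Qed.

(** * The t-entropy on partitions of unity *)

Section entropy_sum.
Context (I : finType).
Implicit Types (p x : I -> R).

Definition entropy_sum p x : \bar R :=
  (\sum_i (if p i == 0%R then 0 else
    (p i)%:E * lne ((x i)%:E * ((p i)^-1)%:E)))%E.

Lemma entropy_sum_fin p x : (forall i, 0 <= p i) -> (forall i, 0 < p i -> 0 < x i) ->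
  entropy_sum p x = (\sum_i p i * ln (x i / p i))%:E.
Proof.
move=> p0 px; rewrite -sumEFin; apply: eq_bigr => i _.
have := p0 i; rewrite le_eqVlt => /predU1P[<-|pi0]; first by rewrite eqxx mul0r.
by rewrite gt_eqF// -EFinM lne_EFin ?divr_gt0 ?px.
Qed.

Lemma entropy_sum_Ny p x i : 0 < p i -> x i <= 0 ->
  entropy_sum p x = -oo%E.
Proof.
move=> pi0 xi0; apply/esum_eqNyP; exists i; split => //.
rewrite (gt_eqF pi0) -EFinM le0_lneNy; first by rewrite gt0_muleNy.
by rewrite lee_fin pmulr_lle0 ?invr_gt0.
Qed.

End entropy_sum.

Section partition.
Context (I : finType) (G : I -> Linfty m) (mu : {scalar Linfty m}).

Lemma tau_nDE n : tau_nD alpha n mu [seq G i | i : I] =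
  ereal_sup [set entropy_sum (fun i => mu (G i))
      (fun i => wnorm (G i) (iter n (L1_shift hA) f)) |
    f in [set f : L1 m | L1norm f = 1]].
Proof.
rewrite /tau_nD; congr (ereal_sup (_ @` _)).
  by apply/funext => f /=; apply/propext; rewrite Lnorm1E; split => [[]|->].
apply/funext => f; rewrite big_map big_enum/=; apply: eq_bigr => i _.
case: ifP => // _; congr (_ * lne (_ * _))%E.
rewrite -wnormE; apply: eq_integral => x _; by rewrite L1_shiftE.
Qed.

Lemma partition_of_unityP : partition_of_unity [seq G i | i : I] <->
  (forall i, {ae m, forall x, 0 <= G i x}) /\
  {ae m, forall x, \sum_i G i x = 1}.
Proof.
split=> -[h1 h2]; split.
- by move=> i; apply: h1; apply/mapP; exists i => //; rewrite mem_enum.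
- by apply: filterS h2 => x; rewrite big_map big_enum.
- by move=> _ /mapP[i _ ->].
- by apply: filterS h2 => x; rewrite big_map big_enum.
Qed.

Hypotheses (mu_state : states mu)
  (G_ge0 : forall i, {ae m, forall x, 0 <= G i x})
  (G_sum1 : {ae m, forall x, \sum_i G i x = 1}).

Lemma state_le f g : {ae m, forall x, f x <= g x} -> mu f <= mu g.
Proof.
have [_ pos _] := mu_state => fg.
rewrite -subr_ge0 -linearB/=; apply: pos; apply: filterS fg => x h.
by change (0 <= g x - f x); rewrite subr_ge0.
Qed.

Lemma state_partition_ge0 i : 0 <= mu (G i).
Proof. by have [_ pos _] := mu_state; exact: pos. Qed.

Lemma state_partition_sum : \sum_i mu (G i) = 1.
Proof.
have [aeq _ one] := mu_state; rewrite -[RHS]one -linear_sum/=; apply: aeq.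
by apply: filterS G_sum1 => x h _; rewrite Linfty_sumE.
Qed.

(** If chi is close to t_i wherever G_i lives, Gibbs' inequality for the numbers
    e^(t_i) x_i, where x_i is the weighted norm for G_i, bounds the entropy sum by
    ln (sum e^(t_i) x_i) - sum t_i mu(G_i).  The first term is at most the
    pressure of chi and the second is almost mu(chi). *)
Lemma tau_nD_le n chi (t : I -> R) (e : R) :
  {ae m, forall x, \sum_i expR (t i) * G i x <= expR (chi x)} ->
  {ae m, forall x, chi x <= \sum_i t i * G i x + e} ->
  ((mu chi)%:E + tau_nD alpha n mu [seq G i | i : I] <= (P n chi + e)%:E)%E.
Proof.
move=> eG chiG.
have mu_chi : mu chi <= \sum_i t i * mu (G i) + e.
  have -> : \sum_i t i * mu (G i) + e = mu (\sum_i t i *: G i + e *: Linfty1 m).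
    have [_ _ one] := mu_state.
    rewrite linearD linearZ/= one mulr1 linear_sum/=; congr (_ + _).
    by apply: eq_bigr => i _; rewrite linearZ.
  apply: state_le; apply: filterS chiG => x.
  change (chi x <= \sum_i t i * G i x + e -> chi x <= (\sum_i t i *: G i) x + e * 1).
  by rewrite Linfty_sumE mulr1.
rewrite addeC -leeBrDr// -EFinB tau_nDE; apply: ge_ereal_sup => _ [f /= f1 <-].
set x := fun i => wnorm (G i) _.
have x0 i : 0 <= x i by exact: wnorm_ge0.
have [px|] := pselect (forall i, 0 < mu (G i) -> 0 < x i); last first.
  move=> /existsNP[i /not_implyP[pi0 /negP xi0]].
  by rewrite (@entropy_sum_Ny _ _ _ i) ?leNye// leNgt.
rewrite entropy_sum_fin//; last exact: state_partition_ge0.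
rewrite lee_fin.
have y0 i : 0 <= expR (t i) * x i by rewrite mulr_ge0 ?expR_ge0.
have ypos i : 0 < mu (G i) -> 0 < expR (t i) * x i.
  by move=> ?; rewrite mulr_gt0 ?expR_gt0 ?px.
have := gibbs_inequality state_partition_ge0 state_partition_sum y0 ypos.
have -> : \sum_i mu (G i) * ln (expR (t i) * x i / mu (G i)) =
    \sum_i mu (G i) * ln (x i / mu (G i)) + \sum_i t i * mu (G i).
  rewrite -big_split/=; apply: eq_bigr => i _.
  have := state_partition_ge0 i; rewrite le_eqVlt => /predU1P[<-|pi0].
    by rewrite !mul0r mulr0 addr0.
  rewrite -mulrA lnM ?posrE ?expR_gt0 ?divr_gt0 ?px// expRK mulrDr addrC.
  by rewrite (mulrC (t i)).
have : ln (\sum_i expR (t i) * x i) <= P n chi.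
  rewrite -[leRHS]expRK ler_ln ?posrE ?expR_gt0//; last first.
    rewrite lt0r sumr_ge0// andbT; apply/negP => /eqP/psumr_eq0P h.
    have [i pi0] := sum1_exists_gt0 state_partition_sum.
    by have := ypos i pi0; rewrite h// ltxx.
  have := pressure_ub m_neq0 hA n chi f; rewrite f1 mulr1; apply: le_trans.
  rewrite (_ : \sum_i _ = wnorm (\sum_i expR (t i) *: G i) (iter n (L1_shift hA) f)).
    apply: le_wnorm; apply: filterS eG => z.
    by rewrite Linfty_sumE.
  by rewrite wnorm_sum; apply: eq_bigr => i _; rewrite wnormZ.
move: mu_chi; move: (\sum_i mu (G i) * ln _) (\sum_i t i * mu (G i)) (ln _)
  (P n chi) (mu chi).
move=> a b c q r; lra.
Qed.

Lemma partition_expR_le (t : I -> R) : {ae m, forall x,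
  expR ((\sum_i t i *: G i) x) <= (\sum_i expR (t i) *: G i) x}.
Proof.
have G0 : {ae m, forall x i, 0 <= G i x}.
  by apply: filter_forall => j; exact: G_ge0.
apply: filterS2 G0 G_sum1 => x Gx0 Gx1; rewrite 2!Linfty_sumE.
have := @expR_sum_le R I (fun i => G i x) t Gx0 Gx1.
by congr (expR _ <= _); apply: eq_bigr => i _; rewrite mulrC.
Qed.

Lemma partition_le1 i : {ae m, forall x, G i x <= 1}.
Proof.
have G0 : {ae m, forall x i, 0 <= G i x}.
  by apply: filter_forall => j; exact: G_ge0.
apply: filterS2 G0 G_sum1 => x Gx0 Gx1.
by rewrite -[leRHS]Gx1 (bigD1 i)//= lerDl sumr_ge0.
Qed.

(** [entropy_duality] for the set K of the vectors of weighted norms of unit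
    functions.  Its hypothesis on the linear form with coefficients e^(t_i) is the
    assumed inequality for Psi = sum t_i G_i, since e^Psi <= sum e^(t_i) G_i. *)
Lemma tau_nD_ge n c : (forall Psi, c + mu Psi <= P n Psi) ->
  (c%:E <= tau_nD alpha n mu [seq G i | i : I])%E.
Proof.
move=> cP; rewrite tau_nDE.
pose sh (f : L1 m) : L1 m := iter n (L1_shift hA) f.
pose K := [set x : I -> R | exists2 f : L1 m, L1norm f = 1 &
  x = fun i => wnorm (G i) (sh f)].
have [C C0 hC] := L1norm_shift_le hA.
have K_cvx x y (s : R) : K x -> K y -> 0 <= s <= 1 ->
    K (fun i => (1 - s) * x i + s * y i).
  move=> [f f1 ->] [f' f'1 ->] s01.
  have [h hE] := L1_convex_abs f f' s01.
  exists h.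
    by rewrite (L1norm_cvx (f1 := f) (f2 := f') hE) f1 f'1 2!mulr1 subrK.
  apply/funext => i; apply: wnorm_cvx => z.
  by rewrite !L1_shiftE hE.
have K_ge0 x i : K x -> 0 <= x i by move=> [f _ ->]; exact: wnorm_ge0.
have K_leC x i : K x -> x i <= C ^+ n.
  move=> [f f1 ->]; have := hC n f; rewrite f1 mulr1; apply: le_trans.
  by apply: le_wnorm; exact: partition_le1.
have K_dual (t : I -> R) y : (forall x, K x -> \sum_i expR (t i) * x i <= y) ->
    expR (c + \sum_i mu (G i) * t i) <= y.
  move=> Ky; pose Psi : Linfty m := \sum_i t i *: G i.
  have muPsi : mu Psi = \sum_i mu (G i) * t i.
    by rewrite linear_sum/=; apply: eq_bigr => i _; rewrite linearZ/= mulrC.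
  have le_y (f : L1 m) : L1norm f = 1 -> wnorm (Linfty_exp Psi) (sh f) <= y.
    move=> f1; apply: (@le_trans _ _ (wnorm (\sum_i expR (t i) *: G i) (sh f))).
      by apply: le_wnorm; apply: filterS (partition_expR_le t).
    rewrite wnorm_sum; apply: le_trans (Ky (fun i => wnorm (G i) (sh f)) _);
      last by exists f.
    by apply: ler_sum => i _; rewrite wnormZ.
  have [f f1 f0] := exists_shift_pos m_neq0 hA n.
  have y0 : 0 < y by apply: lt_le_trans (le_y f f1); exact: wnorm_exp_gt0.
  rewrite -muPsi -[y]lnK ?posrE// ler_expR; apply: (le_trans (cP Psi)).
  by apply: (@pressure_le _ _ _ m alpha m_neq0 hA) => h h1; rewrite lnK ?posrE// le_y.
apply/lee_addgt0Pr => e e0.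
have [x [[f f1 xE] xpos cx]] := @entropy_duality R I (fun i => mu (G i)) K c (C ^+ n)
  state_partition_ge0 state_partition_sum K_cvx K_ge0 K_leC K_dual e e0.
rewrite -leeBlDr// -EFinB; apply: (@le_trans _ _ (entropy_sum (fun i => mu (G i)) x)).
  by rewrite entropy_sum_fin ?lee_fin//; exact: state_partition_ge0.
by apply: ereal_sup_ubound; exists f => //; rewrite xE.
Qed.

End partition.

Lemma Linfty_indic_subproof (A : set X) : measurable A ->
  (\1_A : X -> R) \in Lfun m +oo.
Proof.
move=> mA; apply: (@bounded_Linfty _ _ _ _ _ 1); first exact: measurable_indic.
by apply: aeW => x; rewrite ger0_norm// indicE; case: (_ \in _).
Qed.

Lemma measurable_superlevel chi (s : R) : measurable [set x | s <= chi x].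
Proof.
rewrite [X in measurable X](_ : _ = chi @^-1` `[s, +oo[%classic).
  by rewrite -[X in measurable X]setTI; exact: measurable_funPT.
by apply/seteqP; split => x /=; rewrite in_itv/= andbT.
Qed.

Definition superlevel chi (s : R) : Linfty m :=
  Lfun_Sub (leey 1%E) (Linfty_indic_subproof (measurable_superlevel chi s)).

Lemma superlevelE chi s x : superlevel chi s x = (s <= chi x)%R%:R.
Proof.
change (\1_[set x | s <= chi x] x = (s <= chi x)%R%:R :> R).
by rewrite indicE; congr (_%:R); rewrite mem_setE.
Qed.

(** The members are differences of indicators of consecutive superlevel sets of
    chi: they take the values 0 and 1, and their sum telescopes to 1 because chi
    lies between the extreme levels. *)
Lemma level_partition chi (e : R) : 0 < e -> exists (N : nat)
    (G : 'I_N -> Linfty m) (t : 'I_N -> R),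
  [/\ forall i, {ae m, forall x, 0 <= G i x},
      {ae m, forall x, \sum_i G i x = 1},
      {ae m, forall x, \sum_i expR (t i) * G i x <= expR (chi x)} &
      {ae m, forall x, chi x <= \sum_i t i * G i x + e}].
Proof.
move=> e0; have [M chiM] := Linfty_bounded chi.
pose N := (Num.truncn ((M + M) / e)).+1.
pose s (i : nat) : R := - M + i%:R * e.
have sN : M < s N.
  have : (M + M) / e < N%:R by exact: truncnS_gt.
  by rewrite ltr_pdivrMr// /s; lra.
have sS i : s i.+1 = s i + e by rewrite /s -natr1; ring.
pose G (i : 'I_N) : Linfty m := superlevel chi (s i) - superlevel chi (s i.+1).
have GE i x : G i x = (s i <= chi x)%R%:R - (s i.+1 <= chi x)%R%:R.
  change (superlevel chi (s i) x - superlevel chi (s i.+1) x =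
    (s i <= chi x)%R%:R - (s i.+1 <= chi x)%R%:R).
  by rewrite 2!superlevelE.
have GP i x : G i x = 0 \/ G i x = 1 /\ s i <= chi x < s i.+1.
  rewrite GE; have [h1|h1] := leP (s i) (chi x);
    have [h2|h2] := leP (s i.+1) (chi x) => /=.
  - by left; rewrite subrr.
  - by right; rewrite subr0.
  - by move: h1 h2; rewrite sS; lra.
  - by left; rewrite subrr.
have Gsum x : `|chi x| <= M -> \sum_i G i x = 1.
  rewrite ler_norml => /andP[M1 M2].
  under eq_bigr do rewrite GE.
  rewrite -(big_mkord predT (fun i => (s i <= chi x)%R%:R - (s i.+1 <= chi x)%R%:R)).
  under eq_bigr do rewrite -opprB.
  rewrite sumrN telescope_sumr//.
  have -> : s 0%N <= chi x by rewrite /s mul0r addr0.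
  have -> : s N <= chi x = false by apply/negbTE; rewrite -ltNge; exact: le_lt_trans sN.
  by rewrite /= sub0r opprK.
exists N, G, (fun i => s i); split.
- move=> i; apply: aeW => x; have [->|[-> _]] := GP i x; [exact: lexx|exact: ler01].
- exact: filterS chiM.
- apply: filterS chiM => x /Gsum Gx1.
  rewrite -[leRHS]mulr1 -[X in _ * X]Gx1 mulr_sumr; apply: ler_sum => i _.
  have [->|[-> /andP[h _]]] := GP i x; first by rewrite !mulr0.
  by rewrite !mulr1 ler_expR.
- apply: filterS chiM => x /Gsum Gx1.
  have chiG (i : 'I_N) : chi x * G i x <= s i * G i x + e * G i x.
    have [->|[-> /andP[_ h]]] := GP i x; first by rewrite !mulr0 addr0.
    by rewrite !mulr1 -sS ltW.
  rewrite -[leLHS]mulr1 -[e in leRHS]mulr1 -[X in _ * X <= _]Gx1.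
  rewrite -[X in _ + _ * X]Gx1 2!mulr_sumr -big_split.
  by apply: ler_sum => i _; exact: chiG.
Qed.

Lemma tau_n_le n chi (mu : {scalar Linfty m}) : states mu ->
  ((mu chi)%:E + tau_n alpha n mu <= (P n chi)%:E)%E.
Proof.
move=> mu_state; apply/lee_addgt0Pr => e e0.
have [N [G [t [G0 G1 h1 h2]]]] := level_partition chi e0.
rewrite -EFinD; apply: (le_trans _ (tau_nD_le mu_state G0 G1 n h1 h2)).
rewrite leeD2l//; apply: ereal_inf_lbound; exists [seq G i | i : 'I_N] => //.
exact/partition_of_unityP.
Qed.

Lemma tau_n_ge n c (mu : {scalar Linfty m}) : states mu ->
  (forall Psi, c + mu Psi <= P n Psi) -> (c%:E <= tau_n alpha n mu)%E.
Proof.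
move=> mu_state cP; apply: le_ereal_inf_tmp => _ [D + <-].
have -> : D = [seq tnth (in_tuple D) i | i : 'I_(size D)].
  exact: (esym (map_tnth_enum (in_tuple D))).
by move=> /partition_of_unityP[D0 D1]; exact: tau_nD_ge.
Qed.

Lemma invariant_Birkhoff (mu : {scalar Linfty m}) n chi : invariant_states hA mu ->
  mu (S n chi) = n%:R * mu chi.
Proof.
move=> [_ inv]; rewrite linear_sum/= -[n in RHS]card_ord -sum1_card natr_sum mulr_suml.
apply: eq_bigr => i _; rewrite mul1r.
by elim: (i : nat) => // k IH; rewrite iterS inv.
Qed.

End variational.

(** * The variational principle *)

Local Open Scope ereal_scope.

Theorem theorem1 (R : realType) (d : measure_display) (X : measurableType d)
    (m : {sigma_finite_measure set X -> \bar R}) (m_neq0 : m setT != 0)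
    (alpha : {mfun X >-> X}) (hA : shift_bounded m alpha)
    (phi : Linfty m) :
  [/\ cvgn (log_norm_seq m alpha phi),
      (exists2 mu, invariant_states hA mu &
         lambda m alpha phi = (mu phi)%:E + t_entropy alpha mu)
    & (forall mu, invariant_states hA mu ->
         (mu phi)%:E + t_entropy alpha mu <= lambda m alpha phi)].
Proof.
have cv := @log_norm_seq_cvg _ _ _ m alpha m_neq0 hA phi.
set l := ereal_inf _ in cv.
have lamE : lambda m alpha phi = l by apply/cvg_lim => //.
have upper mu : invariant_states hA mu -> (mu phi)%:E + t_entropy alpha mu <= l.
  move=> mu_inv; have [mu_state _] := mu_inv.
  apply: le_ereal_inf_tmp => _ [n /= n0 <-].
  have n0R : (0 < n%:R :> R)%R by rewrite ltr0n.
  apply: (@le_trans _ _ ((mu phi)%:E + (n%:R^-1)%:E * tau_n alpha n mu)).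
    by rewrite leeD2l//; apply: ereal_inf_lbound; exists n.
  have := tau_n_le m_neq0 hA n (Birkhoff_sum hA n phi) mu_state.
  rewrite (invariant_Birkhoff _ _ mu_inv) => h.
  have -> : (mu phi)%:E + (n%:R^-1)%:E * tau_n alpha n mu =
      (n%:R^-1)%:E * ((n%:R * mu phi)%:E + tau_n alpha n mu).
    rewrite muleDr//.
    by rewrite -EFinM mulrA mulVf ?gt_eqF// mul1r.
  by rewrite [leRHS]EFinM lee_pmul2l// lte_fin invr_gt0.
split; [by apply/cvg_ex; exists l | | by move=> mu /upper; rewrite lamE].
have [g gle] :=
  linear_below_convex (growth_rate_convex m_neq0 hA phi) (growth_rate0 m_neq0 hA phi).
have g_inv := subgradient_invariant m_neq0 gle.
exists g => //; rewrite lamE; apply/eqP; rewrite eq_le upper// andbT.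
(* when the spectral radius is 0, any invariant state attains the maximum *)
have [->|lNy] := eqVneq l -oo; first exact: leNye.
have lb (n : nat) : (0 < n)%N ->
    l <= (n%:R^-1 * pressure alpha n (Birkhoff_sum hA n phi))%:E.
  by move=> n0; apply: ereal_inf_lbound; exists n.
have lfin : l \is a fin_num.
  rewrite fin_numE lNy/=; apply/negP => /eqP ly.
  by have := lb 1%N isT; rewrite ly.
rewrite -leeBlDl// -(fineK lfin) -EFinB.
apply: le_ereal_inf_tmp => _ [n /= n0 <-].
have n0R : (0 < n%:R :> R)%R by rewrite ltr0n.
have lbR (k : nat) : (0 < k)%N ->
    (k%:R * fine l <= pressure alpha k (Birkhoff_sum hA k phi))%R.
  move=> k0; have := lb k k0; rewrite -[leLHS](fineK lfin) lee_fin.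
  by rewrite -ler_pdivrMl ?invr_gt0 ?ltr0n// invrK.
have := tau_n_ge m_neq0 hA (proj1 g_inv)
  (fun Psi => subgradient_le_pressure m_neq0 gle lbR Psi n0).
have -> : (fine l - g phi)%:E = (n%:R^-1)%:E * (n%:R * (fine l - g phi))%:E.
  by rewrite -EFinM mulrA mulVf ?gt_eqF// mul1r.
by move=> h; rewrite lee_pmul2l// lte_fin invr_gt0.
Qed.
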